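(* Let $E$ be a smooth manifold homeomorphic to $\mathbb{R}^4$. Suppose that, for some Riemannian metric on $E$, there is a proper Lipschitz function $\rho\colon E\to\mathbb{R}$ whose set of critical values $\{\rho(x) : x\in E \text{ is a critical point of } \rho\}$ is bounded. Then $E$ satisfies the DFT condition.
   Context: DFT condition. A smooth manifold $E$ homeomorphic to $\mathbb{R}^4$ satisfies the DFT condition if for every compact subset $K\subset E$ there exists an open set $U\subset E$ such that (1) $K\subset U$; (2) the closure $\overline{U}$ of $U$ in $E$ is homeomorphic to the closed ball $D^4$; (3) $U$ can be engulfed by itself rel $K$, meaning: there exists a smooth ambient isotopy of $E$ from the identity to a diffeomorphism $\iota\colon E\to E$ such that $\overline{U}\subset\iota(U)$ and the isotopy is the identity on $K$ at all times. Lipschitz functions and critical points. Lipschitz is understood with respect to the Riemannian distance of the chosen metric (which is not assumed complete), and proper means that preimages of compact sets are compact. Since $\rho$ need not be smooth, critical points are understood in the standard generalized (nonsmooth) sense which extends the notion of Grove and Shiohama for distance functions: for $x\in E$ and $v\in T_xE$ put, in a smooth chart around $x$, $$\rho^{\circ}(x;v)=\limsup_{y\to x,\ t\downarrow 0}\frac{\rho(y+tv)-\rho(y)}{t}$$ (this is independent of the chart). The point $x$ is a critical point of $\rho$ if $\rho^{\circ}(x;v)\ge 0$ for all $v\in T_xE$; equivalently, $0$ belongs to the Clarke generalized differential of $\rho$ at $x$. For the distance function from a point $p$ in a complete Riemannian manifold, a point $q\ne p$ is critical in this sense if and only if for every $v\in T_qE$ there is a minimal geodesic from $q$ to $p$ whose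 initial direction makes an angle at most $\pi/2$ with $v$ (the Grove-Shiohama definition). *)

(* Defs.v *)
From HB Require Import structures.
From mathcomp Require Import all_boot all_order all_algebra.
From mathcomp Require Import all_classical all_reals all_analysis.

Set Implicit Arguments.
Unset Strict Implicit.
Unset Printing Implicit Defensive.

Import Order.TTheory GRing.Theory Num.Theory.
Import numFieldNormedType.Exports.

Local Open Scope classical_set_scope.
Local Open Scope ring_scope.

Section Differentiability.
Context {R : realType} {V W : normedModType R}.

(* All the directional derivatives of order at most k exist and are continuous
   on O; for O open in a finite-dimensional V this is the usual class C^k. *)
Fixpoint Ck_open (k : nat) (O : set V) (f : V -> W) : Prop :=
  (forall x, O x -> {for x, continuous f}) /\
  match k with
  | 0 => True
  | k'.+1 => forall v : V,
      (forall x, O x -> derivable f x v) /\ Ck_open k' O (fun x => 'D_v f x)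
  end.

Definition smooth_open (O : set V) (f : V -> W) : Prop :=
  forall k, Ck_open k O f.

(* On an arbitrary subset A (such as a closed interval, or its product with an
   open set), f is smooth when it extends smoothly near each point of A. *)
Definition Ck_on (k : nat) (A : set V) (f : V -> W) : Prop :=
  forall x, A x -> exists O : set V, exists g : V -> W,
    [/\ open O, O x, Ck_open k O g & forall y, A y -> O y -> f y = g y].

Definition smooth_on (A : set V) (f : V -> W) : Prop :=
  forall x, A x -> exists O : set V, exists g : V -> W,
    [/\ open O, O x, smooth_open O g & forall y, A y -> O y -> f y = g y].

End Differentiability.

Definition homeomorphic {T S : topologicalType} (A : set T) (B : set S) : Prop :=
  exists f : T -> S, exists g : S -> T,
    [/\ (forall x, A x -> B (f x) /\ g (f x) = x),
        (forall y, B y -> A (g y) /\ f (g y) = y),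
        {within A, continuous f} & {within B, continuous g}].

(* The norm of 'rV[R]_n in the library is the sup norm, hence the explicit
   Euclidean norm. *)
Definition euclidean_closed_ball (R : realType) (n : nat) : set 'rV[R]_n :=
  [set v | \sum_(i < n) v ord0 i ^+ 2 <= 1].

(* The values of chart_map outside chart_dom, and of chart_inv outside the
   image of the chart, are irrelevant. *)
Record chart (R : realType) (n : nat) (E : topologicalType) := Chart {
  chart_dom : set E;
  chart_map : E -> 'rV[R]_n;
  chart_inv : 'rV[R]_n -> E;
  chart_dom_open : open chart_dom;
  chart_img_open : open (chart_map @` chart_dom);
  chart_mapK : forall x, chart_dom x -> chart_inv (chart_map x) = x;
  chart_map_continuous : {within chart_dom, continuous chart_map};
  chart_inv_continuous :
    {within chart_map @` chart_dom, continuous chart_inv}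
}.

Definition chart_img {R : realType} {n : nat} {E : topologicalType}
    (c : chart R n E) : set 'rV[R]_n :=
  chart_map c @` chart_dom c.

Section Manifolds.
Context {R : realType} {n : nat} {E : topologicalType}.
Implicit Types (A : set (chart R n E)) (c d : chart R n E).

Definition transition c d : 'rV[R]_n -> 'rV[R]_n :=
  chart_map d \o chart_inv c.

(* The atlas need not be maximal. *)
Definition smooth_manifold A : Prop :=
  [/\ hausdorff_space E, @second_countable E,
      forall x, exists2 c, A c & chart_dom c x &
      forall c d, A c -> A d ->
        smooth_on (chart_map c @` (chart_dom c `&` chart_dom d))
                  (transition c d)].

Definition smooth_map A (f : E -> E) : Prop :=
  continuous f /\
  forall c d, A c -> A d ->
    smooth_on [set y | chart_img c y /\ chart_dom d (f (chart_inv c y))]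
              (fun y => chart_map d (f (chart_inv c y))).

Definition diffeomorphism A (f : E -> E) : Prop :=
  smooth_map A f /\
  exists g : E -> E, [/\ smooth_map A g, cancel f g & cancel g f].

(* Joint smoothness on [0, 1] x E of F, whose values for t outside [0, 1] are
   irrelevant. *)
Definition smooth_homotopy A (F : R -> E -> E) : Prop :=
  {within `[0, 1] `*` [set: E], continuous (fun p : R * E => F p.1 p.2)} /\
  forall c d, A c -> A d ->
    smooth_on
      [set p : R * 'rV[R]_n | [/\ p.1 \in `[0, 1], chart_img c p.2 &
                                  chart_dom d (F p.1 (chart_inv c p.2))]]
      (fun p : R * 'rV[R]_n => chart_map d (F p.1 (chart_inv c p.2))).

Definition smooth_ambient_isotopy A (F : R -> E -> E) : Prop :=
  [/\ smooth_homotopy A F,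
      forall t, t \in `[0, 1] -> diffeomorphism A (F t) &
      forall x, F 0 x = x].

Definition self_engulfed_rel A (U K : set E) : Prop :=
  exists F : R -> E -> E,
    [/\ smooth_ambient_isotopy A F,
        closure U `<=` F 1 @` U &
        forall t x, t \in `[0, 1] -> K x -> F t x = x].

Definition bilinear_value (G : 'M[R]_n) (v w : 'rV[R]_n) : R :=
  (v *m G *m w^T) ord0 ord0.

(* G c x is the Gram matrix, in the coordinates of c, of the inner product on
   the tangent space at x. *)
Definition riemannian_metric A (G : chart R n E -> E -> 'M[R]_n) : Prop :=
  [/\ forall c, A c -> smooth_on (chart_img c) (fun y => G c (chart_inv c y)),
      forall c x, A c -> chart_dom c x -> (G c x)^T = G c x,
      forall c x v, A c -> chart_dom c x -> v != 0 ->
        0 < bilinear_value (G c x) v v &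
      forall c d x v w, A c -> A d -> chart_dom c x -> chart_dom d x ->
        bilinear_value (G c x) v w =
        bilinear_value (G d x) ('D_v (transition c d) (chart_map c x))
                               ('D_w (transition c d) (chart_map c x))].

Definition piecewise_C1_curve A (gamma : R -> E) : Prop :=
  {within `[0, 1], continuous gamma} /\
  exists k : nat, exists tau : nat -> R,
    [/\ tau 0%N = 0, tau k = 1,
        forall i, (i < k)%N -> tau i < tau i.+1 &
        forall i c, (i < k)%N -> A c ->
          Ck_on 1 [set t | t \in `[tau i, tau i.+1] /\ chart_dom c (gamma t)]
                (chart_map c \o gamma)].

(* Where gamma is differentiable, the set below is a singleton, as a Riemannian
   metric is compatible with changes of charts; the finitely many other times
   do not contribute to the length. *)
Definition speed A G (gamma : R -> E) (t : R) : R :=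
  xget 0 [set s | exists c, [/\ A c, chart_dom c (gamma t) &
    s = Num.sqrt (bilinear_value (G c (gamma t))
                    (derive1 (chart_map c \o gamma) t)
                    (derive1 (chart_map c \o gamma) t))]].

Definition curve_length A G (gamma : R -> E) : \bar R :=
  (\int[lebesgue_measure]_(t in `[0%R, 1%R]) (speed A G gamma t)%:E)%E.

Definition riemannian_distance A G (x y : E) : \bar R :=
  ereal_inf [set l | exists gamma : R -> E,
    [/\ piecewise_C1_curve A gamma, gamma 0 = x, gamma 1 = y &
        l = curve_length A G gamma]].

Definition riemannian_lipschitz A G (rho : E -> R) : Prop :=
  exists2 L : R, 0 <= L &
    forall x y, (`|rho x - rho y|%:E <= L%:E * riemannian_distance A G x y)%E.

(* rho^o(x; v), with v given by its coordinates in the chart c around x. *)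
Definition clarke_derivative c (rho : E -> R) (x : E) (v : 'rV[R]_n) : \bar R :=
  limf_esup
    (fun p : 'rV[R]_n * R =>
       ((rho (chart_inv c (p.1 + p.2 *: v)) - rho (chart_inv c p.1)) / p.2)%:E)
    (filter_prod (nbhs (chart_map c x)) (0 : R)^'+).

Definition critical_point A (rho : E -> R) (x : E) : Prop :=
  forall c, A c -> chart_dom c x ->
  forall v : 'rV[R]_n, (0 <= clarke_derivative c rho x v)%E.

Definition critical_values A (rho : E -> R) : set R :=
  rho @` [set x | critical_point A rho x].

Definition proper_function (rho : E -> R) : Prop :=
  forall B : set R, compact B -> compact (rho @^-1` B).

End Manifolds.

Definition DFT_condition {R : realType} {E : topologicalType}
    (A : set (chart R 4 E)) : Prop :=
  forall K : set E, compact K ->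
  exists U : set E,
    [/\ open U, K `<=` U,
        homeomorphic (closure U) (@euclidean_closed_ball R 4) &
        self_engulfed_rel A U K].

(* Main.v *)
Require Import Defs.
From HB Require Import structures.
From mathcomp Require Import all_boot all_order all_algebra.
From mathcomp Require Import all_classical all_reals all_analysis.
From mathcomp Require Import ring lra.

(** Why the theorem holds.  Put [sg x = |rho x|].  Passing to the absolute value
    makes every sublevel set of [sg] compact, whatever the number of ends of
    [rho], and a direction of descent of [rho] at a non-critical point gives,
    up to sign, a direction of ascent of [sg]: where [sg] exceeds the absolute
    values of all critical values, each point has a chart and a constant vector
    [v] such that short displacements along [v] strictly increase [sg] nearby.

    Given the compact [K], choose a level [a] above [sg] on [K] and above the
    absolute values of the critical values.  The homeomorphism with R^4 is used
    once, to find an open set [U] that corresponds to a round ball and contains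
    [{sg <= a + 1}]; its closure lies in some [{sg <= hi}].  It is enough to find a smooth isotopy,
    fixed on [{sg <= a}], which pushes [{sg < a + 1}] over [{sg <= hi}].

    No vector field is integrated.  The isotopy is a composite of finitely many
    elementary pushes [y |-> y + t s b(y) v], each in one chart, with [b] a
    smooth bump and [s] small ([ascending_local]).  A push never decreases [sg],
    and it strictly increases [sg] at each point that it moves.  These two
    properties survive composition, and so does the property of displacing onto
    a given set ([moves_onto_comp]).  By compactness some composite [F] displaces
    onto every point of [{a + 1 <= sg <= hi}]; the gain of [sg] there is bounded
    below, so a high iterate of [F] covers [{sg <= hi}] starting from
    [{sg < a + 1}] ([ascending_sweep]).

    Two analytic facts support this.  A push has a smooth inverse
    ([push_inv_smooth]): the inverse is [y - m(y) v] where [m] solves a scalar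
    contraction, and the formula for the derivative of [m] improves its
    regularity by one order at a time.  And [rho] is continuous
    ([riemannian_lipschitz_continuous]), since a straight segment in a chart
    bounds the Riemannian distance from above. *)

Set Implicit Arguments.
Unset Strict Implicit.
Unset Printing Implicit Defensive.

Import Order.TTheory GRing.Theory Num.Theory.
Import numFieldNormedType.Exports.

Local Open Scope classical_set_scope.
Local Open Scope ring_scope.

(** * Calculus of functions of class C^k *)

Section CkAlgebra.
Context {R : realType} {V : normedModType R}.

Lemma near_eq_continuous (S T : topologicalType) (f g : S -> T) x :
  (\near x, f x = g x) -> {for x, continuous f} -> {for x, continuous g}.
Proof.
move=> fg cf; rewrite /prop_for /continuous_at -[g x](nbhs_singleton fg).
exact/(cvg_trans _ cf)/near_eq_cvg.
Qed.

Lemma Ck_open_is_derive (W : normedModType R) k (O : set V) (f : V -> W) v x :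
  Ck_open k.+1 O f -> O x -> is_derive x v f ('D_v f x).
Proof. by move=> [_ /(_ v)[df _]] Ox; apply: derivableP; exact: df. Qed.

Lemma Ck_open_derive (W : normedModType R) k (O : set V) (f : V -> W) v :
  Ck_open k.+1 O f -> Ck_open k O (fun x => 'D_v f x).
Proof. by move=> [_ /(_ v)[]]. Qed.

Lemma Ck_open_subset (W : normedModType R) k (O O' : set V) (f : V -> W) :
  O' `<=` O -> Ck_open k O f -> Ck_open k O' f.
Proof.
move=> sO; elim: k f => [|k IH] f /= [cf df]; split => //.
- by move=> x /sO; exact: cf.
- by move=> x /sO; exact: cf.
- by move=> v; have [d1 d2] := df v; split; [move=> x /sO; exact: d1|exact: IH].
Qed.

Lemma Ck_open_eq (W : normedModType R) k (O : set V) (f g : V -> W) :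
  open O -> (forall x, O x -> f x = g x) -> Ck_open k O f -> Ck_open k O g.
Proof.
move=> oO; elim: k f g => [|k IH] f g fg /=.
  move=> [cf _]; split=> // x Ox; apply: near_eq_continuous (cf x Ox).
  by apply: filterS (open_nbhs_nbhs (conj oO Ox)).
move=> [cf df].
have nfg x : O x -> \near x, f x = g x.
  by move=> Ox; apply: filterS (open_nbhs_nbhs (conj oO Ox)).
split=> [x Ox|v]; first exact: near_eq_continuous (nfg x Ox) (cf x Ox).
have [d1 d2] := df v; split=> [x Ox|].
  exact: near_eq_derivable (nfg x Ox) (d1 x Ox).
by apply: IH d2 => x Ox; exact/near_eq_derive/nfg.
Qed.

(** A formula for each directional derivative is easier to exhibit than the
    operator ['D_v], and the two agree only on the set [O]. *)
Lemma Ck_openS (W : normedModType R) k (O : set V) (f : V -> W) :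
  open O -> (forall x, O x -> {for x, continuous f}) ->
  (forall v, exists2 df : V -> W,
     forall x, O x -> is_derive x v f (df x) & Ck_open k O df) ->
  Ck_open k.+1 O f.
Proof.
move=> oO cf df; split => // v; have [g dg kg] := df v.
split=> [x Ox|]; first by have [] := dg x Ox.
by apply: Ck_open_eq kg => // x Ox; have [_ ->] := dg x Ox.
Qed.

Lemma Ck_openW (W : normedModType R) k (O : set V) (f : V -> W) :
  Ck_open k.+1 O f -> Ck_open k O f.
Proof.
elim: k f => [|k IH] f [cf df]; first by split.
by split=> // v; have [d1 /IH d2] := df v.
Qed.

Lemma Ck_open_cst (W : normedModType R) k (O : set V) (a : W) :
  Ck_open k O (fun=> a).
Proof.
elim: k a => [|k IH] a; first by split=> // x _; exact: cst_continuous.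
split=> [x _|v]; first exact: cst_continuous.
split=> [x _|]; first exact: derivable_cst.
by rewrite [X in Ck_open _ _ X](_ : _ = fun=> 0) //; apply/funext => x; exact: derive_cst.
Qed.

Lemma Ck_openD (W : normedModType R) k (O : set V) (f g : V -> W) :
  open O -> Ck_open k O f -> Ck_open k O g -> Ck_open k O (fun x => f x + g x).
Proof.
move=> oO; elim: k f g => [|k IH] f g kf kg.
  by split=> // x Ox; apply: continuousD; [exact: kf.1|exact: kg.1].
apply: Ck_openS => // [x Ox|v].
  by apply: continuousD; [exact: kf.1|exact: kg.1].
exists (fun x => 'D_v f x + 'D_v g x); last by apply: IH; exact: Ck_open_derive.
move=> x Ox; apply: is_deriveD.
- exact: Ck_open_is_derive kf Ox.
- exact: Ck_open_is_derive kg Ox.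
Qed.

Lemma Ck_openM k (O : set V) (f g : V -> R) :
  open O -> Ck_open k O f -> Ck_open k O g -> Ck_open k O (fun x => f x * g x).
Proof.
move=> oO; elim: k f g => [|k IH] f g kf kg.
  by split=> // x Ox; apply: continuousM; [exact: kf.1|exact: kg.1].
apply: Ck_openS => // [x Ox|v].
  by apply: continuousM; [exact: kf.1|exact: kg.1].
exists (fun x => f x * 'D_v g x + g x * 'D_v f x).
  move=> x Ox; apply: is_deriveM.
  - exact: Ck_open_is_derive kf Ox.
  - exact: Ck_open_is_derive kg Ox.
by apply: Ck_openD => //; apply: IH => //; (exact: Ck_openW || exact: Ck_open_derive).
Qed.

Lemma Ck_openN k (O : set V) (f : V -> R) :
  open O -> Ck_open k O f -> Ck_open k O (fun x => - f x).
Proof.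
move=> oO kf; rewrite (_ : (fun x => - f x) = fun x => (-1) * f x).
  by apply: Ck_openM => //; exact: Ck_open_cst.
by apply/funext => x; rewrite mulN1r.
Qed.

Lemma Ck_openV k (O : set V) (f : V -> R) :
  open O -> (forall x, O x -> f x != 0) ->
  Ck_open k O f -> Ck_open k O (fun x => (f x)^-1).
Proof.
move=> oO f0; elim: k => [|k IH] kf.
  by split=> // x Ox; apply: continuousV; [exact: f0|exact: kf.1].
apply: Ck_openS => // [x Ox|v].
  by apply: continuousV; [exact: f0|exact: kf.1].
exists (fun x => - ((f x)^-1 * (f x)^-1) * 'D_v f x).
  move=> x Ox; have /derivableP := derivableV (f0 x Ox) ((kf.2 v).1 x Ox).
  by rewrite deriveV ?f0//; [rewrite expr2 invfM|exact: (kf.2 v).1].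
have := IH (Ck_openW kf) => kv.
apply: Ck_openM => //; last exact: Ck_open_derive.
by apply: Ck_openN => //; exact: Ck_openM.
Qed.

Lemma Ck_open_prod k (O : set V) (I : Type) (s : seq I) (f : I -> V -> R) :
  open O -> (forall i, Ck_open k O (f i)) ->
  Ck_open k O (fun x => \prod_(i <- s) f i x).
Proof.
move=> oO kf; elim: s => [|i s IH].
  rewrite (_ : (fun x => _) = fun=> 1); first exact: Ck_open_cst.
  by apply/funext => x; rewrite big_nil.
rewrite (_ : (fun x => _) = fun x => f i x * \prod_(j <- s) f j x).
  exact: Ck_openM.
by apply/funext => x; rewrite big_cons.
Qed.

Lemma Ck_open_sum k (O : set V) (I : Type) (s : seq I) (f : I -> V -> R) :
  open O -> (forall i, Ck_open k O (f i)) ->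
  Ck_open k O (fun x => \sum_(i <- s) f i x).
Proof.
move=> oO kf; elim: s => [|i s IH].
  rewrite (_ : (fun x => _) = fun=> 0); first exact: Ck_open_cst.
  by apply/funext => x; rewrite big_nil.
rewrite (_ : (fun x => _) = fun x => f i x + \sum_(j <- s) f j x).
  exact: Ck_openD.
by apply/funext => x; rewrite big_cons.
Qed.

Lemma Ck_open_linear (W : normedModType R) k (O : set V) (f : {linear V -> W}) :
  open O -> continuous f -> Ck_open k O f.
Proof.
move=> oO cf; case: k => [|k]; first by split=> // x _; exact: cf.
apply: Ck_openS => // [x _|v]; first exact: cf.
exists (fun=> f v); last exact: Ck_open_cst.
move=> x _; have df : differentiable f x by exact: linear_differentiable.
by apply: DeriveDef; [exact: diff_derivable|rewrite deriveE// diff_lin].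
Qed.

Lemma continuous_rowP (S : topologicalType) n (f : S -> 'rV[R]_n) x :
  {for x, continuous f} <-> forall i, {for x, continuous (fun y => f y ord0 i)}.
Proof.
split=> [cf i|cf].
  exact: (continuous_comp cf (@coord_continuous R 1 n ord0 i (f x))).
apply/cvgrPdist_lt => e e0; rewrite /continuous_at in cf.
have cfi i : \forall y \near x, `|f x ord0 i - f y ord0 i| < e.
  by have /cvgrPdist_lt/(_ e e0) := cf i.
near=> y.
rewrite [ltLHS]/Num.Def.normr/= mx_normrE; apply/bigmax_ltP; split=> //= -[i j] _.
rewrite !mxE/= ord1; move: j; near: y; exact: filter_forall.
Unshelve. all: by end_near. Qed.

Lemma Ck_open_rowP k n (O : set V) (f : V -> 'rV[R]_n) : open O ->
  Ck_open k O f <-> forall i, Ck_open k O (fun x => f x ord0 i).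
Proof.
move=> oO; elim: k f => [|k IH] f; split=> kf.
- by move=> i; split=> // x /(kf.1)/continuous_rowP.
- by split=> // x Ox; apply/continuous_rowP => i; exact: (kf i).1.
- move=> i; split=> [x /(kf.1)/continuous_rowP//|v].
  have [d1 d2] := kf.2 v; split=> [x /d1/derivable_mxP//|].
  move/(IH _).1/(_ i): d2; apply: Ck_open_eq => // x /d1 dx.
  by rewrite derive_mx// mxE.
- split=> [x Ox|v]; first by apply/continuous_rowP => i; exact: (kf i).1.
  have d1 x : O x -> derivable f x v.
    by move=> Ox; apply/derivable_mxP => i j; rewrite ord1; exact: ((kf j).2 v).1.
  split=> //; apply/(IH _).2 => i; apply: Ck_open_eq ((kf i).2 v).2 => // x Ox.
  by rewrite derive_mx ?mxE//; exact: d1.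
Qed.

End CkAlgebra.

(** * Differentiability of C^1 functions and composition *)

Section Chain.
Context {R : realType}.

Lemma is_derive_line (V W : normedModType R) (f : V -> W) x v (t : R) df :
  is_derive (x + t *: v) v f df -> is_derive t 1 (fun s : R => f (x + s *: v)) df.
Proof.
have E : (fun h : R => h^-1 *: (((fun s : R => f (x + s *: v)) \o shift t) (h *: 1)
           - f (x + t *: v)))
       = (fun h => h^-1 *: ((f \o shift (x + t *: v)) (h *: v) - f (x + t *: v))).
  apply/funext => h /=; congr (_ *: (f _ - _)).
  by rewrite -[h *: 1]/(h * 1) mulr1 scalerDl addrCA addrA.
by move=> [d1 d2]; split; rewrite ?/derivable /derive E.
Qed.

(** The increment [a] may have either sign, so the intermediate point is only
    located by its absolute value. *)
Lemma MVT_line (V : normedModType R) (f : V -> R) (x v : V) (a : R) (df : V -> R) :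
  (forall t : R, `|t| <= `|a| -> is_derive (x + t *: v) v f (df (x + t *: v))) ->
  exists2 t : R, `|t| <= `|a| & f (x + a *: v) - f x = df (x + t *: v) * a.
Proof.
move=> d; pose F (s : R) := f (x + s *: v); pose D s := df (x + s *: v).
have dF (t : R) : `|t| <= `|a| -> is_derive t 1 F (D t).
  by move=> ta; apply: is_derive_line; exact: d.
have cF l u : (forall t : R, t \in `[l, u] -> `|t| <= `|a|) ->
    {within `[l, u], continuous F}.
  move=> H; apply: derivable_within_continuous => t tI.
  by have [] := dF t (H t tI).
have F0 : F 0 = f x by rewrite /F scale0r addr0.
have [a0|a0] := leP 0 a.
  have B (t : R) : t \in `[0, a] -> `|t| <= `|a|.
    by rewrite in_itv/= => /andP[t0 ta]; rewrite !ger0_norm.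
  have [t tI E] := @MVT_segment R F D 0 a a0
    (fun t ti => dF t (B t (subset_itv_oo_cc ti))) (cF _ _ B).
  by exists t; [exact: B|rewrite -F0 -/(F a) E subr0].
have B (t : R) : t \in `[a, 0] -> `|t| <= `|a|.
  rewrite in_itv/= => /andP[t0 ta]; rewrite !ler0_norm ?lerN2//.
  exact: ltW.
have [t tI E] := @MVT_segment R F D a 0 (ltW a0)
    (fun t ti => dF t (B t (subset_itv_oo_cc ti))) (cF _ _ B).
exists t; first exact: B.
by rewrite -F0 -/(F a) -[LHS]opprB E sub0r mulrN opprK.
Qed.

Lemma rowE_le_norm n (w : 'rV[R]_n) i : `|w ord0 i| <= `|w|.
Proof.
rewrite [leRHS]/Num.Def.normr/= mx_normrE.
exact: (le_bigmax _ (fun ij : 'I_1 * 'I_n => `|w ij.1 ij.2|) (ord0, i)).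
Qed.

Lemma row_norm_le n (w : 'rV[R]_n) (e : R) :
  0 <= e -> (forall i, `|w ord0 i| <= e) -> `|w| <= e.
Proof.
move=> e0 H; rewrite [leLHS]/Num.Def.normr/= mx_normrE.
by apply/bigmax_leP; split=> //= -[i j] _; rewrite ord1.
Qed.

Lemma row_norm_lt n (w : 'rV[R]_n) (e : R) :
  0 < e -> (forall i, `|w ord0 i| < e) -> `|w| < e.
Proof.
move=> e0 H; rewrite [ltLHS]/Num.Def.normr/= mx_normrE.
by apply/bigmax_ltP; split=> //= -[i j] _; rewrite ord1.
Qed.

Section C1.
Variables (n : nat) (O : set 'rV[R]_n) (g : 'rV[R]_n -> R).
Hypotheses (oO : open O) (gC1 : Ck_open 1 O g).

Let e_ (i : 'I_n) : 'rV[R]_n := delta_mx ord0 i.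

Let L (y w : 'rV[R]_n) : R := \sum_(i < n) w ord0 i * 'D_(e_ i) g y.

Let L_linear y : linear (L y).
Proof.
move=> a u v; rewrite /L scaler_sumr -big_split/=; apply: eq_bigr => i _.
by rewrite !mxE mulrDl -[_ *: (_ * _)]/(_ * (_ * _)) mulrA.
Qed.

Let L_continuous y : continuous (L y).
Proof.
suff kL : Ck_open 0 setT (L y) by move=> w; exact: kL.1.
have k0 i : Ck_open 0 setT (fun w : 'rV[R]_n => w ord0 i * 'D_(e_ i) g y).
  apply: (Ck_openM openT); last exact: Ck_open_cst.
  by split=> // w _; exact: coord_continuous.
exact: (Ck_open_sum (index_enum 'I_n) openT k0).
Qed.

Let trunc (w : 'rV[R]_n) (k : nat) : 'rV[R]_n :=
  \row_i (if (i < k)%N then w ord0 i else 0).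

Let truncS w (k : nat) (kn : (k < n)%N) :
  trunc w k.+1 = trunc w k + w ord0 (Ordinal kn) *: e_ (Ordinal kn).
Proof.
apply/rowP => i; rewrite !mxE eqxx/= ltnS leq_eqVlt -val_eqE/=.
have [ik|ik] := eqVneq (i : nat) k.
  rewrite ik ltnn/= mulr1 add0r; congr (w _ _); exact: val_inj.
by rewrite /= mulr0 addr0.
Qed.

(** The increment of [g] is telescoped along the coordinate axes.  Truncating [w]
    does not increase its sup norm, so the path stays in the ball where the
    partial derivatives are close to their values at [y]. *)
Let C1_approx y (eps : R) : O y -> 0 < eps -> \forall w \near (0 : 'rV[R]_n),
  `|g (y + w) - g y - L y w| <= eps * `|w|.
Proof.
move=> Oy eps0; set e := eps / n.+1%:R.
have e0 : 0 < e by rewrite divr_gt0.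
have [d d0 dP] : exists2 d : R, 0 < d & forall z : 'rV[R]_n, `|y - z| < d ->
    O z /\ forall i, `|'D_(e_ i) g y - 'D_(e_ i) g z| < e.
  have : \forall z \near y, O z /\ forall i, `|'D_(e_ i) g y - 'D_(e_ i) g z| < e.
    apply: filterI; first exact: open_nbhs_nbhs.
    have H i : \forall z \near y, `|'D_(e_ i) g y - 'D_(e_ i) g z| < e.
      by have /cvgrPdist_lt/(_ _ e0) := (gC1.2 (e_ i)).2.1 y Oy.
    have := @filter_forall _ _ _ _ _ H. exact.
  move=> /nbhs_ballP[d /= d0 H]; exists d => // z yz.
  by apply: H; rewrite -ball_normE/= .
near=> w.
have wd : `|w| < d by near: w;
  have := @pseudometric_normed_Zmodule.nbhs0_lt _ 'rV[R]_n d d0; apply.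
(* Each coordinate contributes an error [e * |w|], with [e = eps / n.+1]. *)
have key k : (k <= n)%N -> `|g (y + trunc w k) - g y - L y (trunc w k)| <= e * k%:R * `|w|.
  elim: k => [|k IH] kn.
    have -> : trunc w 0 = 0 by apply/rowP => i; rewrite !mxE.
    rewrite addr0 subrr sub0r normrN mulr0 mul0r.
    by rewrite (_ : L y 0 = 0) ?normr0// /L big1// => i _; rewrite mxE mul0r.
  rewrite (truncS w kn); set i := Ordinal kn; set x := y + trunc w k.
  have near_y (t : R) : `|t| <= `|w ord0 i| -> `|y - (x + t *: e_ i)| < d.
    move=> tw; apply: le_lt_trans wd.
    rewrite /x -addrA opprD addrA subrr sub0r normrN.
    apply: row_norm_le => // j; rewrite !mxE eqxx/=.
    case: (ltnP j k) => jk.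
      have -> : (j == i) = false by apply/negbTE; rewrite -val_eqE/= ltn_eqF.
      by rewrite mulr0 addr0 rowE_le_norm.
    rewrite add0r; case: eqVneq => _; rewrite ?mulr1 ?mulr0 ?normr0//.
    by apply: le_trans tw _; exact: rowE_le_norm.
  have [t tw E] := @MVT_line _ g x (e_ i) (w ord0 i) (fun z => 'D_(e_ i) g z)
    (fun t tw => Ck_open_is_derive _ gC1 (dP _ (near_y t tw)).1).
  have De := (dP _ (near_y t tw)).2 i.
  have -> : L y (trunc w k + w ord0 i *: e_ i) = w ord0 i * 'D_(e_ i) g y + L y (trunc w k).
    rewrite addrC L_linear; congr (_ + _); rewrite -[_ *: _]/(_ * _); congr (_ * _).
    rewrite /L (bigD1 i)//= mxE !eqxx mul1r big1 ?addr0// => j ji.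
    by rewrite mxE (negbTE ji) mul0r.
  rewrite addrA -/x (_ : _ - _ - _ = (g x - g y - L y (trunc w k))
     + ('D_(e_ i) g (x + t *: e_ i) - 'D_(e_ i) g y) * w ord0 i); last first.
    by rewrite mulrBl -E; ring.
  apply: le_trans (ler_normD _ _) _.
  rewrite -[k.+1%:R]natr1 mulrDr mulrDl mulr1 lerD ?IH//; first exact: ltnW.
  rewrite normrM distrC ler_pM ?(ltW De)//; exact: rowE_le_norm.
have tw : trunc w n = w by apply/rowP => i; rewrite !mxE ltn_ord.
have := key n (leqnn n); rewrite tw => /le_trans; apply.
rewrite ler_wpM2r// /e -mulrA ler_piMr ?(ltW eps0)//.
by rewrite ler_pdivrMl// mulr1 ler_nat.
Unshelve. all: by end_near. Qed.

Lemma C1_differentiable y : O y -> differentiable g y.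
Proof.
move=> Oy.
pose LM := GRing.isLinear.Build _ _ _ _ _ (L_linear y).
pose Ll : {linear _ -> _} := HB.pack (L y) LM.
have cL : continuous Ll by exact: L_continuous.
have H := @diff_unique R 'rV[R]_n R g Ll y cL.
match type of H with ?P -> _ => have HP : P end.
  apply/eqaddoP => eps eps0; have := C1_approx Oy eps0.
  apply: filterS => w /=.
  by rewrite !fctE/= opprD addrA [w + y]addrC.
by apply/diff_locallyP; rewrite (H HP); split.
Qed.

End C1.

Lemma derive_lineE (V W : normedModType R) (f : V -> W) x v :
  'D_v f x = 'D_1 (fun h : R => f (h *: v + x)) 0.
Proof.
rewrite /derive; set g1 := fun h => h^-1 *: _; set g2 := fun h => h^-1 *: _.
suff -> : g1 = g2 by [].
by rewrite funeqE /g1 /g2 => h /=; rewrite addr0 scale0r add0r [_%:A]mulr1.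
Qed.

(** The chain rule in terms of partial derivatives: each factor is again a
    composite or a coordinate, which lets the induction on the order of
    differentiability in [Ck_open_comp] go through. *)
Lemma is_derive_comp_row (V : normedModType R) n (O : set 'rV[R]_n)
    (g : 'rV[R]_n -> R) (f : V -> 'rV[R]_n) x v :
  open O -> Ck_open 1 O g -> O (f x) -> derivable f x v ->
  is_derive x v (g \o f) (\sum_(i < n) 'D_v f x ord0 i * 'D_(delta_mx ord0 i) g (f x)).
Proof.
move=> oO kg Ofx df.
have dg : differentiable g (f x) by exact: (C1_differentiable oO kg Ofx).
pose F (h : R) := f (h *: v + x).
have F0 : F 0 = f x by rewrite /F scale0r add0r.
have dF : differentiable F 0 := (derivable1_diffP F 0).1 ((derivable1P f x v).1 df).
have dgF : differentiable (g \o F) 0 by apply: differentiable_comp; [exact: dF|rewrite F0].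
have E : 'D_v f x = 'd F 0 1 by rewrite derive_lineE deriveE.
split; first exact: ((derivable1P (g \o f) x v).2 ((derivable1_diffP (g \o F) 0).2 dgF)).
rewrite derive_lineE -[LHS]/('D_1 (g \o F) 0) deriveE//.
have dgF0 : differentiable g (F 0) by rewrite F0.
rewrite (diff_comp dF dgF0) /= F0 -E [X in 'd _ _ X]row_sum_delta linear_sum/=.
by apply: eq_bigr => i _; rewrite (deriveE _ dg) linearZ.
Qed.

Lemma Ck_open_comp (V : normedModType R) n k (O' : set V) (O : set 'rV[R]_n)
    (g : 'rV[R]_n -> R) (f : V -> 'rV[R]_n) :
  open O' -> open O -> (forall x, O' x -> O (f x)) ->
  Ck_open k O' f -> Ck_open k O g -> Ck_open k O' (fun x => g (f x)).
Proof.
move=> oO' oO fO; elim: k g => [|k IH] g kf kg.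
  split=> // x Ox; apply: (continuous_comp (kf.1 x Ox)); exact/(kg.1)/fO.
apply: Ck_openS => // [x Ox|v].
  apply: (continuous_comp (kf.1 x Ox)); exact/(kg.1)/fO.
exists (fun x => \sum_(i < n) 'D_v f x ord0 i * 'D_(delta_mx ord0 i) g (f x)).
  move=> x Ox; apply: (is_derive_comp_row oO) => //; last exact: (kf.2 v).1.
    by elim: (k) kg => // j IHj /Ck_openW.
  exact: fO.
apply: Ck_open_sum => // i; apply: Ck_openM => //.
  by have /(Ck_open_rowP _ _ oO').1/(_ i) := (kf.2 v).2.
apply: (IH (fun y => 'D_(delta_mx ord0 i) g y)); first exact: Ck_openW.
exact: Ck_open_derive.
Qed.

End Chain.

(** * Flat functions and smooth bumps *)

Section Flat.
Context {R : realType}.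

(** The functions [x^-j exp(-1/x)] extended by zero form a family stable under
    differentiation, hence all of them are smooth at once. *)
Definition flat (j : nat) (x : R) : R :=
  if 0 < x then x^-1 ^+ j * expR (- x^-1) else 0.

Lemma flat_ge0 j x : 0 <= flat j x.
Proof.
rewrite /flat; case: ifPn => // x0.
by rewrite mulr_ge0 ?expR_ge0// exprn_ge0// invr_ge0 ltW.
Qed.

Lemma flat_gt0 j x : (0 < flat j x) = (0 < x).
Proof.
rewrite /flat; case: ifPn => [x0|_]; last by rewrite ltxx.
by rewrite mulr_gt0 ?expR_gt0// exprn_gt0// invr_gt0.
Qed.

(** One term of the exponential series. *)
Lemma pow_expRN_le (u : R) k : 0 <= u -> u ^+ k.+1 * expR (- u) <= k.+1`!%:R.
Proof.
move=> u0; rewrite expRN ler_pdivrMr ?expR_gt0//.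
rewrite mulrC -ler_pdivrMr; last by rewrite ltr0n fact_gt0.
by apply: le_trans (expR_ge1Dxn k u0); rewrite lerDr.
Qed.

Lemma flat_le j x : flat j x <= j.+1`!%:R * `|x|.
Proof.
rewrite /flat; case: ifPn => [x0|_]; last by rewrite mulr_ge0.
rewrite gtr0_norm// -ler_pdivrMr// mulrAC -exprSr pow_expRN_le//.
by rewrite invr_ge0 ltW.
Qed.

Lemma flat0_le1 x : flat 0 x <= 1.
Proof.
rewrite /flat; case: ifPn => // x0.
by rewrite expr0 mul1r expRN invf_le1 ?expR_gt0// -expR0 ler_expR invr_ge0 ltW.
Qed.

Lemma flat2_le2 x : flat 2 x <= 2.
Proof.
rewrite /flat; case: ifPn => // x0.
by apply: (@pow_expRN_le _ 1); rewrite invr_ge0 ltW.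
Qed.

(** At the origin the difference quotient of one member of the family is the next
    member, which tends to zero by [flat_le]. *)
Lemma is_derive_flat j (x : R) : is_derive x 1 (flat j) (- j%:R * flat j.+1 x + flat j.+2 x).
Proof.
have [x0|x0|->] := ltgtP x 0.
- have -> : - j%:R * flat j.+1 x + flat j.+2 x = 0.
    by rewrite /flat ltNge (ltW x0)/= mulr0 addr0.
  have N : \near x, cst 0 x = flat j x.
    near=> y; rewrite /flat ltNge (_ : y <= 0)//.
    by apply: ltW; near: y; exact: lt_nbhsl.
  exact: (near_eq_is_derive N).
- pose F : R -> R := (fun y => y^-1) ^+ j * (expR \o (-%R \o (fun y => y^-1))).
  have N : \near x, F x = flat j x.
    near=> y; rewrite /flat (_ : 0 < y)//; last by near: y; exact: lt_nbhsr.
    by rewrite /F !fctE ?exprfctE.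
  have xN0 : x != 0 by rewrite gt_eqF.
  have dV : is_derive x 1 (fun y : R => y^-1) (- x ^- 2 *: 1).
    split; first exact: derivableV.
    by rewrite (@deriveV _ _ id)// derive_id.
  suff D : is_derive x 1 F (- j%:R * flat j.+1 x + flat j.+2 x).
    exact: (near_eq_is_derive N D).
  apply: is_derive_eq.
  rewrite /flat x0 !fctE ?exprfctE /= -![_ *: _]/(_ * _).
  case: (j) => [|i]; rewrite !mulr1 -?exprVn.
    by rewrite ?expr0 ?mul0r ?mulr0; ring.
  rewrite /= !exprS. ring.
- have E h : h^-1 *: ((flat j \o shift 0) (h *: 1) - flat j 0) = flat j.+1 h.
    rewrite /= addr0 [h *: 1]mulr1 /flat ltxx subr0 -[_ *: _]/(_ * _).
    by case: ifP => _; rewrite ?mulr0// mulrA -exprS.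
  have z : - j%:R * flat j.+1 0 + flat j.+2 0 = 0 by rewrite /flat ltxx mulr0 addr0.
  suff H : (fun h => h^-1 *: ((flat j \o shift 0) (h *: 1) - flat j 0)) @ 0^' --> (0 : R).
    rewrite z; split; first by apply/cvg_ex; exists 0.
    exact: cvg_lim.
  rewrite (funext E); apply: cvg_within_filter.
  apply/cvgr0Pnorm_le => e e0.
  have c0 : 0 < (j.+2`!%:R)^-1 * e by rewrite mulr_gt0// invr_gt0 ltr0n fact_gt0.
  near=> h; rewrite ger0_norm ?flat_ge0//; apply: le_trans (flat_le _ _) _.
  rewrite -ler_pdivlMl ?ltr0n ?fact_gt0//.
Unshelve. all: by end_near. Qed.

Lemma flat_lip (x y : R) : `|flat 0 x - flat 0 y| <= 2 * `|x - y|.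
Proof.
have [t _] := @MVT_line R R (flat 0) y 1 (x - y)
  (fun z => - 0%:R * flat 1 z + flat 2 z) (fun t _ => is_derive_flat 0 _).
rewrite [(x - y) *: 1]mulr1 [y + _]addrC subrK => ->.
rewrite oppr0 mul0r add0r normrM ler_wpM2r// ger0_norm ?flat_ge0//.
exact: flat2_le2.
Qed.

Lemma is_derive_comp1 (V : normedModType R) (g : R -> R) (q : V -> R) x v dg dq :
  is_derive (q x) 1 g dg -> is_derive x v q dq -> is_derive x v (g \o q) (dg * dq).
Proof.
move=> Hg Hq; pose F (h : R) := q (h *: v + x).
have F0 : F 0 = q x by rewrite /F scale0r add0r.
have dF : is_derive (0 : R) 1 F dq.
  split; first by apply/(derivable1P q x v).1; have [] := Hq.
  by rewrite -derive_lineE; have [] := Hq.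
rewrite -F0 in Hg; have [d1 d2] := is_derive1_comp Hg dF.
split; first exact: (derivable1P (g \o q) x v).2 d1.
by rewrite derive_lineE.
Qed.

Lemma Ck_open_flat (V : normedModType R) k j (O : set V) (q : V -> R) :
  open O -> Ck_open k O q -> Ck_open k O (fun x => flat j (q x)).
Proof.
have cf i : continuous (flat i).
  move=> x; apply: differentiable_continuous; apply/derivable1_diffP.
  by have [] := is_derive_flat i x.
move=> oO; elim: k j => [|k IH] j kq.
  by split=> // x Ox; apply: (continuous_comp (kq.1 x Ox)); exact: cf.
apply: Ck_openS => // [x Ox|v].
  by apply: (continuous_comp (kq.1 x Ox)); exact: cf.
exists (fun x => (- j%:R * flat j.+1 (q x) + flat j.+2 (q x)) * 'D_v q x).
  move=> x Ox; apply: is_derive_comp1; first exact: is_derive_flat.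
  exact: Ck_open_is_derive kq Ox.
apply: Ck_openM => //; last exact: Ck_open_derive.
have kq' := Ck_openW kq.
apply: Ck_openD => //; last exact: IH.
apply: Ck_openM => //; [exact: Ck_open_cst|exact: IH].
Qed.

Lemma lip_prod (T : Type) (d : T -> T -> R) (I : Type) (s : seq I)
    (f : I -> T -> R) (c : R) :
  (forall i x, 0 <= f i x <= 1) ->
  (forall i x y, `|f i x - f i y| <= c * d x y) ->
  (forall x, 0 <= \prod_(i <- s) f i x <= 1) /\
  (forall x y, `|\prod_(i <- s) f i x - \prod_(i <- s) f i y| <= (size s)%:R * c * d x y).
Proof.
move=> f01 fl; elim: s => [|i s [IH1 IH2]].
  by split=> [x|x y]; rewrite !big_nil ?ler01 ?lexx// subrr normr0 !mul0r.
split=> [x|x y]; rewrite !big_cons.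
  have /andP[a0 a1] := f01 i x; have /andP[b0 b1] := IH1 x.
  by rewrite mulr_ge0//= mulr_ile1.
set P := \prod_(j <- s) f j x; set Q := \prod_(j <- s) f j y.
have -> : f i x * P - f i y * Q = (f i x - f i y) * P + f i y * (P - Q) by ring.
apply: le_trans (ler_normD _ _) _; rewrite !normrM /= -natr1 mulrDl mul1r mulrDl addrC.
have /andP[a0 a1] := f01 i y; have /andP[b0 b1] := IH1 x.
apply: lerD.
  rewrite (ger0_norm a0); apply: le_trans (IH2 x y).
  by rewrite ler_piMl.
rewrite (ger0_norm b0); apply: le_trans (fl i x y).
by rewrite ler_piMr.
Qed.

(** A product of one-dimensional bumps, one per coordinate, is positive exactly on
    a ball of the sup norm.  The global Lipschitz constant determines how far one
    can push while remaining injective. *)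
Lemma smooth_bump n (p : 'rV[R]_n) (r : R) : 0 < r ->
  exists b : 'rV[R]_n -> R, exists2 L : R, 0 <= L &
  [/\ smooth_open setT b, forall y, 0 <= b y <= 1,
      forall y z, `|b y - b z| <= L * `|y - z| &
      forall y, 0 < b y <-> `|p - y| < r].
Proof.
move=> r0.
pose f (i : 'I_n * bool) (y : 'rV[R]_n) : R :=
  flat 0 (r + (-1) ^+ i.2 * (y ord0 i.1 - p ord0 i.1)).
pose b y := \prod_i f i y.
have f01 i y : 0 <= f i y <= 1 by rewrite flat_ge0 flat0_le1.
have fl i y z : `|f i y - f i z| <= 2 * `|y - z|.
  apply: le_trans (flat_lip _ _) _; rewrite ler_wpM2l//.
  rewrite (_ : _ - _ = (-1) ^+ i.2 * (y - z) ord0 i.1).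
    by rewrite normrM normrX normrN1 expr1n mul1r; exact: rowE_le_norm.
  by rewrite !mxE; ring.
have [b01 bl] := lip_prod (index_enum ('I_n * bool)%type) f01 fl.
exists b; exists ((size (index_enum ('I_n * bool)%type))%:R * 2).
  by rewrite mulr_ge0.
split=> //.
- move=> k; apply: (Ck_open_prod _ openT) => i; apply: (Ck_open_flat _ openT).
  apply: (Ck_openD openT); first exact: Ck_open_cst.
  apply: (Ck_openM openT); first exact: Ck_open_cst.
  apply: (Ck_openD openT); last exact: Ck_open_cst.
  have /(Ck_open_rowP _ _ openT).1 : Ck_open k setT (@idfun 'rV[R]_n).
    by apply: (Ck_open_linear _ openT) => x; exact: cvg_id.
  exact.
- move=> y; split=> [b0|yr].
    have f0 i : 0 < f i y.
      rewrite lt_neqAle (andP (f01 i y)).1 andbT eq_sym; apply/negP => /eqP f0.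
      by move: b0; rewrite /b (bigD1 i)//= f0 mul0r ltxx.
    apply: row_norm_lt => // i; rewrite !mxE ltr_norml.
    move: (f0 (i, true)) (f0 (i, false)); rewrite !flat_gt0/= expr1 expr0.
    by move=> *; lra.
  apply: prodr_gt0 => -[i [] ] _; rewrite flat_gt0/= ?expr1 ?expr0;
  have := le_lt_trans (rowE_le_norm _ i) yr; rewrite !mxE ltr_norml; lra.
Qed.

End Flat.

(** * Pushes along a constant vector and their inverses *)

Lemma lipschitz_continuous (R : realType) (V : normedModType R) (f : V -> R) (c : R) :
  (forall y z, `|f y - f z| <= c * `|y - z|) -> continuous f.
Proof.
move=> fl y; apply/cvgrPdist_lt => e e0.
have c0 : 0 < `|c| + 1 by rewrite ltr_wpDl.
have e1 : 0 < e / (`|c| + 1) by rewrite divr_gt0.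
have nz : \forall z \near y, `|y - z| < e / (`|c| + 1).
  by apply/nbhs_ballP; exists (e / (`|c| + 1)) => // z; rewrite -ball_normE.
apply: filterS nz => z yz; apply: le_lt_trans (fl y z) _.
move: yz; rewrite ltr_pdivlMr// mulrC => /(le_lt_trans _); apply.
by rewrite ler_wpM2r//; have := ler_norm c; lra.
Qed.

(** A push displaces [y] by [s * b y] along [v].  The condition [small] makes the
    displacement a contraction with factor one half along the direction [v]. *)
Section Push.
Context {R : realType} {n : nat}.
Variables (b : 'rV[R]_n -> R) (L : R) (v : 'rV[R]_n) (s : R).
Hypotheses (L0 : 0 <= L) (bsm : smooth_open setT b) (b01 : forall y, 0 <= b y <= 1)
  (bl : forall y z, `|b y - b z| <= L * `|y - z|)
  (small : `|s| * L * `|v| <= 2^-1).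

Let cb : continuous b.
Proof. by move=> y; exact: (bsm 0).1. Qed.

(** The preimage of [y] is [y - m v] where [m] is the displacement at that
    preimage; such an [m] exists between [-|s|] and [|s|] by the intermediate
    value theorem. *)
Lemma push_fixpoint_ex y : exists m : R, m = s * b (y - m *: v).
Proof.
pose psi (m : R) := m - s * b (y - m *: v).
have c1 : continuous (fun m : R => y - m *: v).
  by move=> m; apply: cvgB; [exact: cvg_cst|exact: scalel_continuous].
have cpsi : continuous psi.
  move=> m; apply: cvgB; first exact: cvg_id.
  apply: cvgM; first exact: cvg_cst.
  exact: (continuous_comp (c1 m) (@cb _)).
have bound z : `|s * b z| <= `|s|.
  have /andP[b0 b1] := b01 z.
  by rewrite normrM (ger0_norm b0) ler_piMr.
have [m _ m0] : exists2 m, m \in `[- `|s|, `|s|] & psi m = 0.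
  apply: IVT; first by rewrite ge0_cp.
    exact: continuous_subspaceT.
  rewrite ge_min le_max /psi.
  have /ler_normlP[] := bound (y - - `|s| *: v); have /ler_normlP[] := bound (y - `|s| *: v).
  by move=> A B C D; apply/andP; split; apply/orP; [left|right]; lra.
by exists m; apply/eqP; rewrite -subr_eq0; apply/eqP.
Qed.

Definition push_shift (y : 'rV[R]_n) : R := sval (cid (push_fixpoint_ex y)).

Definition push (y : 'rV[R]_n) : 'rV[R]_n := y + (s * b y) *: v.

Definition push_inv (y : 'rV[R]_n) : 'rV[R]_n := y - push_shift y *: v.

Lemma push_shiftE y : push_shift y = s * b (push_inv y).
Proof. by rewrite /push_inv /push_shift; case: cid. Qed.

(** The contraction estimate.  It gives uniqueness of the displacement when
    [y = z], and its Lipschitz dependence on the point in general. *)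
Lemma push_shift_near y z (m m' : R) :
  m = s * b (y - m *: v) -> m' = s * b (z - m' *: v) ->
  `|m - m'| <= 2 * `|s| * L * `|y - z|.
Proof.
move=> Em Em'.
have H : `|m - m'| <= `|s| * L * (`|y - z| + `|m - m'| * `|v|).
  rewrite {1}Em {1}Em' -mulrBr normrM -mulrA ler_wpM2l//.
  apply: le_trans (bl _ _) _; rewrite ler_wpM2l//.
  rewrite (_ : _ - _ - _ = (y - z) - (m - m') *: v).
    apply: le_trans (ler_normB _ _) _. by rewrite normrZ; exact: lexx.
  rewrite scalerBl !opprB addrA [RHS]addrAC; congr (_ - z).
  by rewrite -addrA; congr (_ + _); rewrite addrC.
have S : `|s| * L * (`|m - m'| * `|v|) <= 2^-1 * `|m - m'|.
  by rewrite [`|m - m'| * _]mulrC mulrA ler_wpM2r.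
rewrite mulrDr in H; lra.
Qed.

Lemma pushK : cancel push push_inv.
Proof.
move=> y; rewrite /push_inv.
suff -> : push_shift (push y) = s * b y by rewrite /push addrK.
have H := push_shift_near (push_shiftE (push y)) (y := push y) (z := push y).
apply/eqP; rewrite -subr_eq0 -normr_le0.
apply: le_trans (H (s * b y) _) _; first by rewrite /push addrK.
by rewrite subrr normr0 mulr0.
Qed.

Lemma push_invK : cancel push_inv push.
Proof. by move=> y; rewrite /push -push_shiftE /push_inv subrK. Qed.

Lemma push_shift_lip y z : `|push_shift y - push_shift z| <= 2 * `|s| * L * `|y - z|.
Proof. by apply: push_shift_near; exact: push_shiftE. Qed.

Let push_shift_continuous : continuous push_shift.
Proof.
exact: lipschitz_continuous push_shift_lip.
Qed.

Let D1 z w : is_derive z w b ('D_w b z).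
Proof. exact: (Ck_open_is_derive w (bsm 1)). Qed.

Lemma derive_b_le z w : `|'D_w b z| <= L * `|w|.
Proof.
have [df _] := D1 z w.
rewrite /derive -lim_norm//.
apply: limr_le; first exact: is_cvg_norm.
near=> h; rewrite normrZ normfV.
have h0 : h != 0 by near: h; exact: nbhs_dnbhs_neq.
rewrite ler_pdivrMl ?normr_gt0//; apply: le_trans (bl _ _) _.
by rewrite /= addrK normrZ mulrCA.
Unshelve. all: by end_near. Qed.

Lemma push_denom z : 2^-1 <= 1 + s * 'D_v b z.
Proof.
have : `|s * 'D_v b z| <= 2^-1.
  rewrite normrM; apply: le_trans small; rewrite -mulrA ler_wpM2l//.
  exact: derive_b_le.
by move=> /ler_normlP[]; lra.
Qed.

(** The derivative of the displacement along [w], as a function of the preimage. *)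
Let Q w z := s * 'D_w b z / (1 + s * 'D_v b z).

Let denom0 z : 1 + s * 'D_v b z != 0.
Proof. by apply: lt0r_neq0; apply: lt_le_trans (push_denom z). Qed.

Let Qsm w k : Ck_open k setT (Q w).
Proof.
have kd u : Ck_open k setT (fun z => s * 'D_u b z).
  apply: (Ck_openM openT); first exact: Ck_open_cst.
  exact: Ck_open_derive (bsm k.+1).
apply: (Ck_openM openT) => //; apply: (Ck_openV openT) => //.
by apply: (Ck_openD openT) => //; exact: Ck_open_cst.
Qed.

(** The mean value theorem between the two preimages turns the increment of the
    displacement into an exact value of [Q], so that the derivative follows from
    the continuity of [Q] alone. *)
Let increment y w : exists2 z : 'rV[R]_n,
  `|push_inv y - z| <= 2 * `|w| &
  push_shift (y + w) - push_shift y = Q w z.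
Proof.
set d := push_shift (y + w) - push_shift y.
have dl : `|d| * `|v| <= `|w|.
  have := push_shift_lip (y + w) y; rewrite addrAC subrr add0r -/d => H.
  apply: le_trans (ler_wpM2r _ H) _ => //.
  rewrite -[X in _ <= X]mul1r mulrAC ler_wpM2r//.
  have := small; rewrite mulrAC -!mulrA => H2; lra.
pose u := w - d *: v.
have ul : `|u| <= 2 * `|w|.
  by apply: le_trans (ler_normB _ _) _; rewrite normrZ; lra.
have [t t1] := @MVT_line R _ b (push_inv y) u 1 (fun z => 'D_u b z) (fun t _ => D1 _ _).
rewrite scale1r mulr1 normr1 in t1 *.
have -> : push_inv y + u = push_inv (y + w).
  by rewrite /push_inv /u /d scalerBl opprB addrACA addKr.
set z := push_inv y + t *: u => E.
exists z.
  rewrite /z opprD addrA subrr sub0r normrN normrZ.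
  by apply: le_trans ul; rewrite ler_piMl.
have db : differentiable b z by exact: (C1_differentiable openT (bsm 1)).
have Eu : 'D_u b z = 'D_w b z - d * 'D_v b z.
  by rewrite !(deriveE _ db) /u linearB linearZ.
have Ed : d = s * ('D_w b z - d * 'D_v b z).
  by rewrite -Eu -E mulrBr -!push_shiftE.
rewrite /Q; apply/eqP; rewrite -[_ == _](can2_eq (mulfK (denom0 z)) (divfK (denom0 z))).
by apply/eqP; rewrite mulrDr mulr1 {1}Ed; ring.
Qed.

Let push_shift_is_derive y w : is_derive y w push_shift (Q w (push_inv y)).
Proof.
suff H : (fun h : R => h^-1 *: ((push_shift \o shift y) (h *: w) - push_shift y)) @ 0^' -->
    (Q w (push_inv y)).
  by split; [apply/cvg_ex; exists (Q w (push_inv y))|exact: cvg_lim].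
apply/cvgrPdist_lt => e e0.
have /cvgrPdist_lt/(_ _ e0)/nbhs_ballP[r /= r0 rQ] := (Qsm w 0).1 (push_inv y) I.
near=> h.
have h0 : h != 0 by near: h; exact: nbhs_dnbhs_neq.
have [z zy /= Ez] := increment y (h *: w).
have Qh : Q (h *: w) z = h * Q w z.
  have db : differentiable b z by exact: (C1_differentiable openT (bsm 1)).
  rewrite /Q !(deriveE _ db) (_ : 'd b z (h *: w) = h * 'd b z w); first by ring.
  exact: linearZ.
rewrite [h *: w + y]addrC Ez Qh -[_ *: _]/(_ * _) mulKf//.
apply: rQ; rewrite -ball_normE /=; apply: le_lt_trans zy _.
rewrite normrZ.
have : `|h| < r / (2 * `|w| + 1).
  near: h; apply: dnbhs0_lt; rewrite divr_gt0// ltr_wpDl// mulr_ge0//.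
rewrite ltr_pdivlMr ?ltr_wpDl ?mulr_ge0// => /(le_lt_trans _); apply.
by rewrite mulrDr mulr1 mulrCA lerDl.
Unshelve. all: by end_near. Qed.

(** Bootstrapping: the derivative of the displacement is the smooth function [Q]
    evaluated at the inverse, so it has the regularity already known for the
    inverse, and the displacement gains one order. *)
Lemma push_inv_smooth : smooth_open setT push_inv.
Proof.
have inv_of k : Ck_open k setT push_shift -> Ck_open k setT push_inv.
  move=> km; apply/(Ck_open_rowP _ _ openT) => i.
  rewrite (_ : (fun x => _) = fun y : 'rV[R]_n => y ord0 i + - (push_shift y * v ord0 i));
    last first.
    by apply/funext => y; rewrite !mxE.
  apply: (Ck_openD openT).
    have /(Ck_open_rowP _ _ openT).1 : Ck_open k setT (@idfun 'rV[R]_n).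
      by apply: (Ck_open_linear _ openT) => x; exact: cvg_id.
    exact.
  apply: (Ck_openN openT); apply: (Ck_openM openT) => //; exact: Ck_open_cst.
suff km k : Ck_open k setT push_shift by move=> k; exact: inv_of.
elim: k => [|k IH]; first by split=> // x _; exact: push_shift_continuous.
apply: (Ck_openS openT) => [x _|w]; first exact: push_shift_continuous.
exists (fun y => Q w (push_inv y)); first by move=> x _; exact: push_shift_is_derive.
exact: (Ck_open_comp openT openT (fun _ _ => I) (inv_of _ IH) (Qsm w k)).
Qed.

End Push.

(** * Smooth maps into a manifold and isotopies *)

(** Compactness as an induction principle, which dispenses with finite subcovers:
    if [P K] failed, the sets [B] such that [P] holds of [K] minus [B] would form
    a proper filter without cluster point in [K]. *)
Lemma compact_local_ind (T : topologicalType) (K : set T) (P : set T -> Prop) :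
  compact K -> P set0 -> (forall B C, B `<=` C -> P C -> P B) ->
  (forall B C, P B -> P C -> P (B `|` C)) ->
  (forall x, K x -> exists2 U, nbhs x U & P U) -> P K.
Proof.
move=> cK P0 PS PU Ploc; apply: contrapT => nPK.
pose F : set_system T := [set B | P (K `\` B)].
have FF : ProperFilter F.
  split; first by rewrite /F /= setD0.
  split; first by rewrite /F /= setDT.
    by move=> B C /= PB PC; rewrite /F /= setDIr; exact: PU.
  by move=> B C BC /=; apply: PS => x [Kx nC]; split=> // /BC.
have [|x [Kx clx]] := cK F FF; first by rewrite /F /= setDv.
have [U Ux PU'] := Ploc x Kx.
have : F (~` U) by apply: PS PU' => y [_ /contrapT].
by move=> /clx /(_ Ux)[y []].
Qed.

Section SmoothAt.
Context {R : realType}.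

(** Smoothness on a neighbourhood, not just at the point itself: this is what the
    extension in [smooth_on] provides at a point of an open set. *)
Definition smooth_at (V W : normedModType R) (f : V -> W) (p : V) : Prop :=
  exists O : set V, [/\ open O, O p & smooth_open O f].

Lemma smooth_at_continuous (V W : normedModType R) (f : V -> W) p :
  smooth_at f p -> {for p, continuous f}.
Proof. by move=> [ O [oO Op sf]]; exact: (sf 0).1. Qed.

Lemma smooth_at_near (V W : normedModType R) (f g : V -> W) p :
  (\near p, f p = g p) -> smooth_at f p -> smooth_at g p.
Proof.
move=> nfg [ O [oO Op sf]]; have : nbhs p [set q | f q = g q] by [].
rewrite nbhsE => -[ O1 [oO1 O1p] fg].
exists (O `&` O1); split; [exact: openI|by split|move=> k].
apply: (@Ck_open_eq _ _ _ _ _ f); first exact: openI.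
  by move=> x [_ /fg].
by apply: Ck_open_subset (sf k) => x [].
Qed.

Lemma smooth_at_cst (V W : normedModType R) (a : W) (p : V) :
  smooth_at (fun=> a) p.
Proof. by exists setT; split=> //; [exact: openT|move=> k; exact: Ck_open_cst]. Qed.

Lemma smooth_at_linear (V W : normedModType R) (f : {linear V -> W}) (p : V) :
  continuous f -> smooth_at f p.
Proof.
move=> cf; exists setT; split=> //; first exact: openT.
by move=> k; apply: Ck_open_linear => //; exact: openT.
Qed.

Lemma smooth_at_lift2 (V W1 W2 W : normedModType R) (f : V -> W1) (g : V -> W2)
    (h : V -> W) p :
  (forall k O, open O -> Ck_open k O f -> Ck_open k O g -> Ck_open k O h) ->
  smooth_at f p -> smooth_at g p -> smooth_at h p.
Proof.
move=> H [ O [oO Op sf]] [ O' [oO' Op' sg]].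
exists (O `&` O'); split; [exact: openI|by split|move=> k].
apply: H; first exact: openI.
  by apply: Ck_open_subset (sf k) => x [].
by apply: Ck_open_subset (sg k) => x [].
Qed.

Lemma smooth_atD (V W : normedModType R) (f g : V -> W) p :
  smooth_at f p -> smooth_at g p -> smooth_at (fun q => f q + g q) p.
Proof. by apply: smooth_at_lift2 => k O; exact: Ck_openD. Qed.

Lemma smooth_atM (V : normedModType R) (f g : V -> R) p :
  smooth_at f p -> smooth_at g p -> smooth_at (fun q => f q * g q) p.
Proof. by apply: smooth_at_lift2 => k O; exact: Ck_openM. Qed.

Lemma smooth_atZ (V : normedModType R) n (f : V -> R) (v : 'rV[R]_n) p :
  smooth_at f p -> smooth_at (fun q => f q *: v) p.
Proof.
move=> [ O [oO Op sf]]; exists O; split=> // k.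
apply/(Ck_open_rowP _ _ oO) => i.
rewrite (_ : (fun x => _) = fun q => f q * v ord0 i).
  by apply: Ck_openM => //; exact: Ck_open_cst.
by apply/funext => q; rewrite mxE.
Qed.

Lemma smooth_at_row (V : normedModType R) n (f : V -> 'rV[R]_n) p :
  smooth_at f p -> forall i, smooth_at (fun q => f q ord0 i) p.
Proof.
move=> [ O [oO Op sf]] i; exists O; split=> // k.
by have /(Ck_open_rowP _ _ oO).1 := sf k.
Qed.

Lemma smooth_at_comp1 (V : normedModType R) n (f : V -> 'rV[R]_n)
    (g : 'rV[R]_n -> R) p :
  smooth_at f p -> smooth_at g (f p) -> smooth_at (fun q => g (f q)) p.
Proof.
move=> sfp [ O' [oO' Op' sg]]; have cf := smooth_at_continuous sfp.
move: sfp => [ O [oO Op sf]].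
have : nbhs p (f @^-1` O') by apply: cf; exact: open_nbhs_nbhs.
rewrite nbhsE => -[ O1 [oO1 O1p] fO1].
exists (O `&` O1); split; [exact: openI|by split|move=> k].
apply: (Ck_open_comp _ oO') (sg k); first exact: openI.
  by move=> x [_ /fO1].
by apply: Ck_open_subset (sf k) => x [].
Qed.

Lemma smooth_at_rowP (V : normedModType R) n (f : V -> 'rV[R]_n) p :
  (forall i, smooth_at (fun q => f q ord0 i) p) -> smooth_at f p.
Proof.
move=> /choice[D HD]; pose B := [set q | forall i, D i q].
have oB : open B.
  rewrite openE => q Bq.
  have H i : \forall z \near q, D i z.
    by apply: open_nbhs_nbhs; split; [have [] := HD i|exact: Bq].
  have := @filter_forall _ _ _ _ _ H; exact.
exists B; split=> //; first by move=> i; have [] := HD i.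
move=> k; apply/(Ck_open_rowP _ _ oB) => i.
by have [_ _ /(_ k)] := HD i; apply: Ck_open_subset => x /(_ i).
Qed.

Lemma smooth_at_comp (V : normedModType R) n m (f : V -> 'rV[R]_n)
    (g : 'rV[R]_n -> 'rV[R]_m) p :
  smooth_at f p -> smooth_at g (f p) -> smooth_at (fun q => g (f q)) p.
Proof.
move=> sf sg; apply: smooth_at_rowP => i.
exact: (smooth_at_comp1 sf (smooth_at_row sg i)).
Qed.

Lemma smooth_open_at (V W : normedModType R) (f : V -> W) p :
  smooth_open setT f -> smooth_at f p.
Proof. by move=> sf; exists setT; split => //; exact: openT. Qed.

Lemma smooth_at_on (V W : normedModType R) (B : set V) (f : V -> W) :
  (forall p, B p -> smooth_at f p) -> smooth_on B f.
Proof. by move=> H x /H [ O [oO Ox sf]]; exists O, f. Qed.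

Lemma smooth_on_at (V W : normedModType R) (B : set V) (f : V -> W) p :
  open B -> smooth_on B f -> B p -> smooth_at f p.
Proof.
move=> oB sf Bp; have [ O [g [oO Op sg fg]]] := sf p Bp.
exists (B `&` O); split; [exact: openI|by split|move=> k].
apply: (@Ck_open_eq _ _ _ _ _ g); first exact: openI.
  by move=> x [Bx Ox]; rewrite fg.
by apply: Ck_open_subset (sg k) => x [].
Qed.

End SmoothAt.

Section Manifold.
Context {R : realType} {n : nat} {E : topologicalType}.
Variables (A : set (chart R n E)) (HA : smooth_manifold A).
Implicit Types c d : chart R n E.

Lemma chart_map_cont c x : chart_dom c x -> {for x, continuous (chart_map c)}.
Proof.
move=> cx; have := @chart_map_continuous _ _ _ c.
rewrite continuous_open_subspace; last exact: chart_dom_open.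
by apply; rewrite inE.
Qed.

Lemma chart_inv_cont c y : chart_img c y -> {for y, continuous (chart_inv c)}.
Proof.
move=> cy; have := @chart_inv_continuous _ _ _ c.
rewrite continuous_open_subspace; last exact: chart_img_open.
by apply; rewrite inE.
Qed.

Lemma chart_invK c y : chart_img c y ->
  chart_dom c (chart_inv c y) /\ chart_map c (chart_inv c y) = y.
Proof. by move=> [x cx <-]; rewrite chart_mapK. Qed.

Lemma chart_img_map c x : chart_dom c x -> chart_img c (chart_map c x).
Proof. by move=> cx; exists x. Qed.

Lemma chart_img_nbhs c y : chart_img c y -> \forall z \near y, chart_img c z.
Proof. by move=> cy; apply: open_nbhs_nbhs; split=> //; exact: chart_img_open. Qed.

Lemma chart_dom_nbhs c x : chart_dom c x -> \forall z \near x, chart_dom c z.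
Proof. by move=> cx; apply: open_nbhs_nbhs; split=> //; exact: chart_dom_open. Qed.

Lemma transition_smooth_at c d x : A c -> A d -> chart_dom c x -> chart_dom d x ->
  smooth_at (transition c d) (chart_map c x).
Proof.
move=> Ac Ad cx dx; have [_ _ _ /(_ c d Ac Ad) sm] := HA.
apply: smooth_on_at sm _; last by exists x.
rewrite openE => _ [z [cz dz] <-].
have cz' := chart_img_map cz.
have : \forall y \near chart_map c z, chart_dom d (chart_inv c y).
  by apply: (chart_inv_cont cz'); rewrite chart_mapK//; exact: chart_dom_nbhs.
apply: filterS2 (chart_img_nbhs cz') => y [u cu <-].
by rewrite chart_mapK// => du; exists u.
Qed.

(** A map into the manifold parametrized by a normed space.  Allowing any
    parameter space treats maps of the manifold and homotopies uniformly, the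
    parameters being a chart, or a time and a chart. *)
Definition smooth_into (V : normedModType R) (H : V -> E) (p : V) : Prop :=
  {for p, continuous H} /\
  forall d, A d -> chart_dom d (H p) -> smooth_at (fun q => chart_map d (H q)) p.

Lemma smooth_into_chart (V : normedModType R) (H : V -> E) p c :
  {for p, continuous H} -> A c -> chart_dom c (H p) ->
  smooth_at (fun q => chart_map c (H q)) p -> smooth_into H p.
Proof.
move=> cH Ac cHp sH; split=> // d Ad dHp.
have : smooth_at (fun q => transition c d (chart_map c (H q))) p.
  exact: (smooth_at_comp sH (transition_smooth_at Ac Ad cHp dHp)).
apply: smooth_at_near.
have : \forall q \near p, chart_dom c (H q) by apply: cH; exact: chart_dom_nbhs.
by apply: filterS => q cq; rewrite /transition /= chart_mapK.
Qed.

Lemma smooth_into_near (V : normedModType R) (H H' : V -> E) p :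
  (\near p, H p = H' p) -> smooth_into H p -> smooth_into H' p.
Proof.
move=> HH' [cH sH]; split; first exact: near_eq_continuous HH' cH.
move=> d Ad; rewrite -(nbhs_singleton HH') => dHp.
by apply: smooth_at_near (sH d Ad dHp); apply: filterS HH' => q ->.
Qed.

Lemma smooth_into_chart_inv (V : normedModType R) (f : V -> 'rV[R]_n) p c :
  A c -> chart_img c (f p) -> smooth_at f p ->
  smooth_into (fun q => chart_inv c (f q)) p.
Proof.
move=> Ac cfp sf; have cf := smooth_at_continuous sf.
apply: (@smooth_into_chart _ _ _ c) => //.
- exact: (continuous_comp cf (chart_inv_cont cfp)).
- by have [] := chart_invK cfp.
- apply: smooth_at_near sf.
  have : \forall q \near p, chart_img c (f q) by apply: cf; exact: chart_img_nbhs.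
  by apply: filterS => q /chart_invK[].
Qed.

Definition chart_lift c (f : 'rV[R]_n -> 'rV[R]_n) (x : E) : E :=
  if `[< chart_dom c x >] then chart_inv c (f (chart_map c x)) else x.

Lemma chart_lift_in c f x : chart_dom c x ->
  chart_lift c f x = chart_inv c (f (chart_map c x)).
Proof. by move=> cx; rewrite /chart_lift asboolT. Qed.

Lemma chart_lift_out c f x : ~ chart_dom c x -> chart_lift c f x = x.
Proof. by move=> cx; rewrite /chart_lift asboolF. Qed.

Lemma chart_lift_id c f x :
  (chart_dom c x -> f (chart_map c x) = chart_map c x) -> chart_lift c f x = x.
Proof.
move=> H; case: (pselect (chart_dom c x)) => cx; last exact: chart_lift_out.
by rewrite chart_lift_in// H// chart_mapK.
Qed.

Lemma chart_liftK c f g : cancel f g ->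
  (forall y, chart_img c y -> chart_img c (f y)) ->
  cancel (chart_lift c f) (chart_lift c g).
Proof.
move=> fg fimg x; case: (pselect (chart_dom c x)) => cx; last first.
  by rewrite !chart_lift_out.
have [d1 d2] := chart_invK (fimg _ (chart_img_map cx)).
by rewrite (chart_lift_in _ cx) chart_lift_in// d2 fg chart_mapK.
Qed.

(** The lift remains smooth across the border of the domain of the chart: the
    region where it may differ from the identity is the image of the compact [S],
    which is closed because the manifold is Hausdorff. *)
Lemma smooth_into_lift (V : normedModType R) (H : V -> E) (f : V -> 'rV[R]_n -> 'rV[R]_n)
    p c (S : set 'rV[R]_n) :
  A c -> compact S -> S `<=` chart_img c ->
  (forall q y, ~ S y -> f q y = y) ->
  (forall y, chart_img c y -> chart_img c (f p y)) ->
  (chart_dom c (H p) -> smooth_at (fun q => f q (chart_map c (H q))) p) ->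
  smooth_into H p -> smooth_into (fun q => chart_lift c (f q) (H q)) p.
Proof.
move=> Ac cS Simg fid fimg sf sH; have [cH sHc] := sH.
case: (pselect (chart_dom c (H p))) => cHp.
  have nd : \forall q \near p, chart_dom c (H q) by apply: cH; exact: chart_dom_nbhs.
  have := @smooth_into_chart_inv _ (fun q => f q (chart_map c (H q))) p c Ac.
  move=> /(_ (fimg _ (chart_img_map cHp)) (sf cHp)); apply: smooth_into_near.
  by apply: filterS nd => q cq; rewrite chart_lift_in.
have [Hs _ _ _] := HA.
have clS : closed (chart_inv c @` S).
  apply: compact_closed => //; apply: continuous_compact => //.
  apply: continuous_subspaceW Simg _; exact: chart_inv_continuous.
have nS : ~ (chart_inv c @` S) (H p).
  by move=> [y /Simg /chart_invK[+ _] E1]; rewrite E1.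
apply: smooth_into_near sH.
have : \forall q \near p, ~ (chart_inv c @` S) (H q).
  apply: (cH (~` (chart_inv c @` S))).
  by apply: open_nbhs_nbhs; split=> //; exact: closed_openC.
apply: filterS => q nSq; rewrite chart_lift_id// => cq; apply: fid => Sq.
by apply: nSq; exists (chart_map c (H q)) => //; rewrite chart_mapK.
Qed.

(** Smoothness tested on all parametrized maps, so that stability under
    composition is immediate. *)
Definition smooth_self (g : E -> E) : Prop :=
  forall (V : normedModType R) (H : V -> E) p,
    smooth_into H p -> smooth_into (fun q => g (H q)) p.

Lemma exists_chart x : exists2 c, A c & chart_dom c x.
Proof. by have [_ _ /(_ x)] := HA. Qed.

Lemma smooth_self_continuous g : smooth_self g -> continuous g.
Proof.
move=> sg x; have [c Ac cx] := exists_chart x.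
have cx' := chart_img_map cx.
have sid : smooth_at (@idfun 'rV[R]_n) (chart_map c x).
  by apply: smooth_at_linear => y; exact: cvg_id.
have [cg _] := sg _ _ _ (smooth_into_chart_inv Ac cx' sid).
have := continuous_comp (chart_map_cont cx) cg.
have nd : \forall y \near x, (fun q => g (chart_inv c (idfun q))) (chart_map c y) = g y.
  by apply: filterS (chart_dom_nbhs cx) => y cy /=; rewrite chart_mapK.
exact: near_eq_continuous.
Qed.

Lemma smooth_self_map g : smooth_self g -> smooth_map A g.
Proof.
move=> sg; split; first exact: smooth_self_continuous.
move=> c d Ac Ad; apply: smooth_at_on => y [cy dy].
have sid : smooth_at (@idfun 'rV[R]_n) y.
  by apply: smooth_at_linear => z; exact: cvg_id.
have [_] := sg _ _ _ (smooth_into_chart_inv Ac cy sid); exact.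
Qed.

(** The time is itself a smooth function of the parameters.  With this formulation
    isotopies compose pointwise in time without any chain rule on the product of
    the time line and the manifold. *)
Definition isotopy (F : R -> E -> E) : Prop :=
  [/\ forall t, t \in `[0, 1] ->
        exists g : E -> E, [/\ cancel (F t) g, cancel g (F t) & smooth_self g],
      forall (V : normedModType R) (H : V -> E) (tau : V -> R) p,
        tau p \in `[0, 1] -> smooth_at tau p -> smooth_into H p ->
        smooth_into (fun q => F (tau q) (H q)) p &
      forall x, F 0 x = x].

Lemma isotopy_id : isotopy (fun _ x => x).
Proof. by split=> // t _; exists id; split. Qed.

Lemma isotopy_comp F G : isotopy F -> isotopy G -> isotopy (fun t x => F t (G t x)).
Proof.
move=> [F1 F2 F3] [G1 G2 G3]; split.
- move=> t t01; have [f [f1 f2 f3]] := F1 t t01; have [g [g1 g2 g3]] := G1 t t01.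
  exists (fun x => g (f x)); split=> [x|x|V H p sH]; rewrite ?f1 ?g2//.
  by apply: g3; exact: f3.
- by move=> V H tau p t01 st sH; apply: F2 => //; exact: G2.
- by move=> x; rewrite G3 F3.
Qed.

Lemma isotopy_iter F m : isotopy F -> isotopy (fun t => iter m (F t)).
Proof.
move=> iF; elim: m => [|m IH]; first exact: isotopy_id.
exact: isotopy_comp.
Qed.

Lemma isotopy_smooth_self F t : isotopy F -> t \in `[0, 1] -> smooth_self (F t).
Proof.
move=> [_ F2 _] t01 V H p sH.
by apply: (F2 V H (fun=> t) p t01 _ sH); exact: smooth_at_cst.
Qed.

(** The parameters specialize to a time and a point of a chart. *)
Lemma isotopy_ambient F : isotopy F -> smooth_ambient_isotopy A F.
Proof.
move=> iF; have [F1 F2 F3] := iF; split=> //; last first.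
  move=> t t01; split; first exact/smooth_self_map/isotopy_smooth_self.
  by have [g [g1 g2 g3]] := F1 t t01; exists g; split=> //; exact: smooth_self_map.
have key c (t : R) y : A c -> t \in `[0, 1] -> chart_img c y ->
    smooth_into (fun p : R * 'rV[R]_n => F p.1 (chart_inv c p.2)) (t, y).
  move=> Ac t01 cy.
  apply: (F2 _ (fun p : R * 'rV[R]_n => chart_inv c p.2) fst (t, y)) => //.
    by apply: smooth_at_linear => z; exact: cvg_fst.
  apply: smooth_into_chart_inv => //.
  by apply: smooth_at_linear => z; exact: cvg_snd.
split.
  apply: continuous_in_subspaceT => -[t x]; rewrite inE => -[/= t01 _].
  have [c Ac cx] := exists_chart x.
  have [ck _] := key c t _ Ac t01 (chart_img_map cx).
  have cp : {for (t, x), continuous (fun p : R * E => (p.1, chart_map c p.2))}.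
    have c2 : {for (t, x), continuous (fun p : R * E => chart_map c p.2)}.
      by apply: continuous_comp; [exact: cvg_snd|exact: chart_map_cont].
    have c1 : {for (t, x), continuous (fun p : R * E => p.1)} by exact: cvg_fst.
    exact: (cvg_pair c1 c2).
  have := continuous_comp cp ck.
  apply: near_eq_continuous.
  have : \forall p \near (t, x), chart_dom c p.2.
    exact: (cvg_snd (chart_dom_nbhs cx)).
  by apply: filterS => -[s z] /= cz; rewrite chart_mapK.
move=> c d Ac Ad; apply: smooth_at_on => -[t y] [/= t01 cy dF].
by have [_] := key c t y Ac t01 cy; exact.
Qed.

End Manifold.

(** * Continuity of Lipschitz functions *)

(** Simple functions below [f] are below [g], so no measurability is involved; it
    would be awkward to establish for the speed, which is defined by a choice of
    chart at each time. *)
Lemma ge0_integral_monotone d (T : measurableType d) (R : realType)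
    (mu : {measure set T -> \bar R}) (D : set T) (f g : T -> \bar R) :
  (forall x, D x -> 0 <= f x)%E -> (forall x, D x -> f x <= g x)%E ->
  (\int[mu]_(x in D) f x <= \int[mu]_(x in D) g x)%E.
Proof.
move=> f0 fg; have g0 x : D x -> (0 <= g x)%E.
  by move=> Dx; apply: le_trans (f0 x Dx) (fg x Dx).
rewrite !ge0_integralE//; apply: ereal_sup_le => _ [h hf <-]; exists h => //= x.
by apply: le_trans (hf x) _; exact: lee_restrict.
Qed.

Section RhoContinuous.
Context {R : realType} {n : nat} {E : topologicalType}.
Variables (A : set (chart R n E)) (HA : smooth_manifold A).
Variables (G : chart R n E -> E -> 'M[R]_n) (HG : riemannian_metric A G).
Implicit Types c d : chart R n E.

Lemma bilinear_value_le (M : 'M[R]_n) (w : 'rV[R]_n) (B : R) :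
  (forall i j, `|M i j| <= B) ->
  bilinear_value M w w <= n%:R * (n%:R * B) * `|w| ^+ 2.
Proof.
move=> MB; apply: le_trans (ler_norm _) _.
rewrite /bilinear_value mxE; apply: le_trans (ler_norm_sum _ _ _) _.
apply: (@le_trans _ _ (\sum_(i < n) n%:R * B * `|w| ^+ 2)); last first.
  by rewrite sumr_const card_ord -[leLHS]mulr_natl !mulrA.
apply: ler_sum => j _; rewrite !mxE normrM expr2 mulrA.
apply: ler_pM => //; last exact: rowE_le_norm.
apply: le_trans (ler_norm_sum _ _ _) _.
apply: (@le_trans _ _ (\sum_(i < n) B * `|w|)); last first.
  by rewrite sumr_const card_ord -[leLHS]mulr_natl !mulrA.
apply: ler_sum => i _; rewrite normrM mulrC; apply: ler_pM => //.
exact: rowE_le_norm.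
Qed.

Lemma metric_locally_bounded c x : A c -> chart_dom c x ->
  exists2 C : R, 0 <= C & \forall y \near chart_map c x, chart_img c y /\
    forall w, bilinear_value (G c (chart_inv c y)) w w <= (C * `|w|) ^+ 2.
Proof.
move=> Ac cx; have [sG _ _ _] := HG; have cy := chart_img_map cx.
have sm := smooth_on_at (@chart_img_open _ _ _ c) (sG c Ac) cy.
set g := (fun y => _) in sm; set y0 := chart_map c x in sm cy *.
have cg := smooth_at_continuous sm.
have cgij i j : {for y0, continuous (fun y => g y i j)}.
  exact: (continuous_comp cg (@coord_continuous R n n i j (g y0))).
pose B := \sum_i \sum_j (`|g y0 i j| + 1).
have B0 : 0 <= B by rewrite sumr_ge0// => i _; rewrite sumr_ge0// => j _; rewrite addr_ge0.
have near_ij (ij : 'I_n * 'I_n) : \forall y \near y0, `|g y ij.1 ij.2| <= B.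
  have /cvgrPdist_lt/(_ 1 ltr01) := cgij ij.1 ij.2.
  apply: filterS => y yd; apply: (@le_trans _ _ (`|g y0 ij.1 ij.2| + 1)).
    have -> : g y ij.1 ij.2 = g y0 ij.1 ij.2 - (g y0 ij.1 ij.2 - g y ij.1 ij.2).
      by rewrite opprB addrCA subrr addr0.
    by apply: le_trans (ler_normB _ _) _; rewrite lerD2l ltW.
  rewrite /B (bigD1 ij.1)//= (bigD1 ij.2)//= -addrA lerDl addr_ge0//.
    by rewrite sumr_ge0// => j _; rewrite addr_ge0.
  by rewrite sumr_ge0// => i _; rewrite sumr_ge0// => j _; rewrite addr_ge0.
have nB : \forall y \near y0, forall ij : 'I_n * 'I_n, `|g y ij.1 ij.2| <= B.
  by have := @filter_forall _ _ _ _ _ near_ij; exact.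
(* Adding 1 gives [C <= C ^ 2], which avoids a square root. *)
pose C := n%:R * (n%:R * B) + 1.
have C1 : 1 <= C by rewrite lerDr !mulr_ge0.
exists C; first exact: le_trans C1.
apply: filterS2 (chart_img_nbhs cy) nB => y iy yB; split=> // w.
apply: le_trans (bilinear_value_le _ (fun i j => yB (i, j))) _.
rewrite exprMn ler_wpM2r ?exprn_ge0//.
apply: (@le_trans _ _ C); first by rewrite lerDl.
by rewrite expr2 ler_peMr// (le_trans _ C1).
Qed.

Section Segment.
Variables (c : chart R n E) (y0 w : 'rV[R]_n) (C : R).
Hypotheses (Ac : A c) (C0 : 0 <= C).
Hypothesis segC : forall t : R, t \in `[0, 1] -> chart_img c (y0 + t *: w) /\
  forall w', bilinear_value (G c (chart_inv c (y0 + t *: w))) w' w' <= (C * `|w'|) ^+ 2.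

Let gam (t : R) : E := chart_inv c (y0 + t *: w).

Let gam_smooth (t : R) : t \in `[0, 1] -> smooth_into A gam t.
Proof.
move=> t01; apply: smooth_into_chart_inv => //; first by have [] := segC t01.
apply: smooth_atD; first exact: smooth_at_cst.
apply: smooth_atZ.
by apply: (@smooth_at_linear _ _ _ idfun) => z; exact: cvg_id.
Qed.

Let gam_curve : piecewise_C1_curve A gam.
Proof.
split.
  apply: continuous_in_subspaceT => t; rewrite inE => t01.
  by have [] := gam_smooth t01.
exists 1%N, (fun i => i%:R); split=> // [i|i d].
  by rewrite ltr_nat.
rewrite ltnS leqn0 => /eqP -> Ad t [t01 dt].
have [_ /(_ d Ad dt) [D [oD Dt sD]]] := gam_smooth t01.
by exists D, (chart_map d \o gam).
Qed.

(** The chart in which the speed is read is unknown, but the compatibility of the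
    metric with the transition maps brings the computation back to [c], where the
    velocity of the segment is the constant [w]. *)
Let speed_le (t : R) : t \in `[0, 1] -> 0 <= speed A G gam t <= C * `|w|.
Proof.
move=> t01; have [ct Ct] := segC t01.
rewrite /speed; case: xgetP => [s _ [d [Ad dt ->]]|_]; last first.
  by rewrite lexx mulr_ge0.
rewrite sqrtr_ge0/=.
have [cg cgE] := chart_invK ct.
have E1 : derive1 (chart_map d \o gam) t = 'D_w (transition c d) (chart_map c (gam t)).
  rewrite /gam cgE /derive1 /derive; set g1 := (fun h => _); set g2 := (fun h => _).
  suff -> : g1 = g2 by [].
  apply/funext => h; rewrite /g1 /g2 /transition /gam /=.
  congr (_ *: (chart_map d (chart_inv c _) - _)).
  by rewrite scalerDl addrCA.
have [_ _ _ /(_ c d (gam t) w w Ac Ad cg dt)] := HG.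
rewrite -E1 => <-.
have Cw : 0 <= C * `|w| by rewrite mulr_ge0.
by rewrite -(ger0_norm Cw) -sqrtr_sqr ler_wsqrtr.
Qed.

Lemma riemannian_distance_segment_le :
  (riemannian_distance A G (gam 0) (gam 1) <= (C * `|w|)%:E)%E.
Proof.
apply: (@le_trans _ _ (curve_length A G gam)).
  by apply: ereal_inf_lbound; exists gam; split; first exact: gam_curve.
apply: (@le_trans _ _ (\int[lebesgue_measure]_(t in `[0%R, 1%R]) cst (C * `|w|)%:E t)%E).
  apply: ge0_integral_monotone => t t01; rewrite lee_fin.
    by have /andP[] := speed_le t01.
  by have /andP[] := speed_le t01.
have m1 : lebesgue_measure (`[0%R, 1%R]%classic : set R) = 1%E.
  by rewrite lebesgue_measure_itv /= lte_fin ltr01 -EFinB subr0.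
rewrite integral_cst//= (_ : lebesgue_measure _ = 1%E); first by rewrite mule1.
exact: m1.
Qed.

End Segment.

Lemma riemannian_lipschitz_continuous (rho : E -> R) :
  riemannian_lipschitz A G rho -> continuous rho.
Proof.
move=> [L L0 Hl] x; have [c Ac cx] := exists_chart HA x.
have [C C0 /nbhs_ballP[r /= r0 HC]] := metric_locally_bounded Ac cx.
set y0 := chart_map c x in HC.
apply/cvgrPdist_lt => e e0.
have LC0 : 0 < L * C + 1 by rewrite ltr_wpDl ?mulr_ge0.
pose d := Num.min r (e / (L * C + 1)).
have d0 : 0 < d by rewrite lt_min r0 divr_gt0.
have nd : \forall z \near x, ball y0 d (chart_map c z).
  by apply: (chart_map_cont cx); exact: nbhsx_ballx.
apply: filterS2 (chart_dom_nbhs cx) nd => z cz.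
rewrite -ball_normE /= distrC => zd; set w := chart_map c z - y0 in zd.
have segC (t : R) : t \in `[0, 1] -> chart_img c (y0 + t *: w) /\
  forall w', bilinear_value (G c (chart_inv c (y0 + t *: w))) w' w' <= (C * `|w'|) ^+ 2.
  rewrite in_itv/= => /andP[t0 t1]; apply: HC; rewrite -ball_normE /=.
  rewrite opprD addrA subrr sub0r normrN normrZ ger0_norm//.
  apply: (@le_lt_trans _ _ `|w|); first by rewrite ler_piMl.
  by apply: lt_le_trans zd _; rewrite ge_min lexx.
have := riemannian_distance_segment_le Ac C0 segC.
rewrite scale0r addr0 scale1r /w addrC subrK /y0 !chart_mapK// -/y0 -/w => dist.
rewrite -lte_fin; apply: le_lt_trans (Hl x z) _.
apply: (@le_lt_trans _ _ (L%:E * (C * `|w|)%:E)%E).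
  by apply: lee_wpmul2l => //; rewrite lee_fin.
rewrite -EFinM lte_fin.
have : `|w| < e / (L * C + 1) by apply: lt_le_trans zd _; rewrite ge_min lexx orbT.
rewrite ltr_pdivlMr// mulrC => /(le_lt_trans _); apply.
by rewrite mulrA ler_wpM2r// lerDl.
Qed.

End RhoContinuous.

(** * Isotopies that increase a function *)

Lemma compact_ubound (R : realType) (T : topologicalType) (f : T -> R) (K : set T) :
  continuous f -> compact K -> exists M : R, forall x, K x -> f x <= M.
Proof.
move=> cf cK; apply: (compact_local_ind (P := fun S =>
  exists M, forall x, S x -> f x <= M)) cK _ _ _ _.
- by exists 0.
- by move=> B C BC [M HM]; exists M => x /BC /HM.
- move=> B C [M HM] [N HN]; exists (Num.max M N) => x [/HM|/HN] H;
  by rewrite le_max H ?orbT.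
- move=> x _; exists [set y | f y < f x + 1].
    by apply: (cf x [set s | s < f x + 1]); apply: lt_nbhsl; rewrite ltrDl.
  by exists (f x + 1) => y /ltW.
Qed.

Lemma closed_norm_ball_compact (R : realType) n (p : 'rV[R]_n) (r : R) :
  0 < r -> compact [set y | `|p - y| <= r].
Proof.
move=> r0; rewrite (_ : [set y | _] = closed_ball p r); last first.
  by rewrite closed_ballE.
apply: bounded_closed_compact; last exact: closed_ball_closed.
rewrite closed_ballE//; exists (`|p| + r); split; first exact: num_real.
move=> M HM y /= yr; apply/ltW; apply: le_lt_trans HM.
have -> : y = p - (p - y) by rewrite opprB addrCA subrr addr0.
by apply: le_trans (ler_normB _ _) _; rewrite lerD2l.
Qed.

Section Dynamics.
Context {R : realType} {n : nat} {E : topologicalType}.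
Variables (A : set (chart R n E)) (HA : smooth_manifold A).
Variables (sg : E -> R) (a : R).
Implicit Types c d : chart R n E.

(** The strict increase at displaced points is what makes such isotopies
    composable without losing any displacement. *)
Definition ascending (F : R -> E -> E) : Prop :=
  [/\ isotopy A F,
      forall t z, t \in `[0, 1] -> sg z <= a -> F t z = z &
      forall z, F 1 z <> z -> sg z < sg (F 1 z)].

(** Displacement is recorded at the image: the sweep follows orbits backwards from
    a point that has to be covered. *)
Definition moves_onto (F : R -> E -> E) (S : set E) : Prop :=
  forall z, S (F 1 z) -> F 1 z <> z.

Lemma ascending_le F z : ascending F -> sg z <= sg (F 1 z).
Proof.
move=> [_ _ asc]; case: (pselect (F 1 z = z)) => [->//|/asc/ltW//].
Qed.

Lemma ascending_id : ascending (fun _ x => x).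
Proof. by split=> //; exact: isotopy_id. Qed.

Lemma ascending_comp F G : ascending F -> ascending G ->
  ascending (fun t x => F t (G t x)).
Proof.
move=> aF aG; have [iF fF sF] := aF; have [iG fG sG] := aG; split.
- exact: isotopy_comp.
- by move=> t z t01 za; rewrite fG// fF.
- move=> z FGz; case: (pselect (G 1 z = z)) => [Gz|/sG Gz].
    by rewrite Gz in FGz *; exact: sF.
  by apply: lt_le_trans Gz _; exact: ascending_le.
Qed.

(** A point moved by one factor cannot be moved back by the other one, because the
    function has strictly increased in between. *)
Lemma moves_onto_comp F G S T : ascending F -> ascending G ->
  moves_onto F S -> moves_onto G T ->
  moves_onto (fun t x => F t (G t x)) (S `|` T).
Proof.
move=> aF aG mF mG z HST; have [_ _ sF] := aF; have [_ _ sG] := aG.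
suff lt : sg z < sg (F 1 (G 1 z)) by move=> E1; move: lt; rewrite E1 ltxx.
case: (pselect (F 1 (G 1 z) = G 1 z)) => [E1|/sF lt].
  rewrite E1 in HST *; case: HST => [Sz|/mG/sG//].
  by have := mF (G 1 z); rewrite E1 => /(_ Sz).
by apply: le_lt_trans lt; exact: ascending_le.
Qed.

(** A push in the chart [c] whose bump is supported where displacements along [v]
    increase the function, and whose strength is below both the length [dl] on
    which this holds and the threshold for invertibility. *)
Lemma ascending_local c x v (r1 dl : R) : A c -> chart_dom c x ->
  0 < r1 -> 0 < dl ->
  (forall y, `|chart_map c x - y| < r1 ->
     chart_img c y /\ a < sg (chart_inv c y)) ->
  (forall y t, `|chart_map c x - y| < r1 -> 0 < t < dl ->
     sg (chart_inv c y) < sg (chart_inv c (y + t *: v))) ->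
  exists2 U, nbhs x U & exists2 F, ascending F & moves_onto F U.
Proof.
move=> Ac cx r10 dl0 near_x up; set p := chart_map c x in near_x up.
pose r := r1 / 2; have r0 : 0 < r by rewrite divr_gt0.
have rr1 : r < r1 by rewrite /r; lra.
have [b [L L0 [bsm b01 bl bsupp]]] := smooth_bump p r0.
have b0 y : 0 <= b y by have /andP[] := b01 y.
have b0P y : ~ `|p - y| < r -> b y = 0.
  move=> /bsupp/negP; rewrite -leNgt => H; apply/eqP; rewrite eq_le H.
  exact: b0.
pose Lv := L * `|v| + 1.
have Lv0 : 0 < Lv by rewrite ltr_wpDl// mulr_ge0.
pose s0 := Num.min (dl / 2) (2^-1 / Lv).
have s00 : 0 < s0 by rewrite lt_min !divr_gt0.
have s0dl : s0 < dl by rewrite gt_min; apply/orP; left; lra.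
(* The bound [2^-1 / Lv] in [s0] is the threshold for invertibility. *)
have small t : t \in `[0, 1] -> `|t * s0| * L * `|v| <= 2^-1.
  rewrite in_itv/= => /andP[t0 t1].
  have ts : `|t * s0| <= s0 by rewrite ger0_norm ?mulr_ge0 ?(ltW s00)// ler_piMl ?(ltW s00).
  rewrite -mulrA; apply: (@le_trans _ _ (s0 * Lv)).
    by apply: ler_pM => //; [rewrite mulr_ge0|rewrite lerDl].
  by rewrite -ler_pdivlMr// ge_min lexx orbT.
pose S : set 'rV[R]_n := [set y | `|p - y| <= r].
have cS : compact S by exact: closed_norm_ball_compact.
have Simg : S `<=` chart_img c by move=> y yr; have [] := near_x y (le_lt_trans yr rr1).
pose f (t : R) := push b v (t * s0).
have fid t y : b y = 0 -> f t y = y.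
  by move=> by0; rewrite /f /push by0 mulr0 scale0r addr0.
have notS y : ~ S y -> b y = 0.
  by move=> nS; apply: b0P => /ltW.
have supp_img y : b y <> 0 -> chart_img c y.
  by move=> nb; apply: Simg; apply: contrapT => /notS.
pose g t (t01 : t \in `[0, 1]) := push_inv v (t * s0) bsm b01.
have fK t (t01 : t \in `[0, 1]) : cancel (f t) (g t t01).
  exact: (pushK L0 bsm b01 bl (small t t01)).
have gK t (t01 : t \in `[0, 1]) : cancel (g t t01) (f t) by exact: push_invK.
have gid t (t01 : t \in `[0, 1]) y : b y = 0 -> g t t01 y = y.
  by move=> by0; rewrite -{1}(fid t y by0) fK.
(* A bijection which is the identity off the support preserves the support. *)
have fimg t y : t \in `[0, 1] -> chart_img c y -> chart_img c (f t y).
  move=> t01 cy; case: (pselect (b y = 0)) => [/(fid t) ->//|nb].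
  apply: supp_img => bf; apply: nb.
  by have := gid t t01 _ bf; rewrite fK => {1}->.
have gimg t (t01 : t \in `[0, 1]) y : chart_img c y -> chart_img c (g t t01 y).
  move=> cy; case: (pselect (b y = 0)) => [/(gid t t01) ->//|nb].
  apply: supp_img => bg; apply: nb.
  by have := fid t _ bg; rewrite gK => ->.
pose F t := chart_lift c (f t).
have I1 : (1 : R) \in `[0, 1] by rewrite in_itv/= ler01 lexx.
have incr z : chart_dom c z -> b (chart_map c z) <> 0 -> sg z < sg (F 1 z).
  move=> cz nb; rewrite /F chart_lift_in// -{1}(chart_mapK cz).
  have br : `|p - chart_map c z| < r by apply: contrapT => /b0P.
  apply: up; first exact: lt_trans br rr1.
  have bz0 : 0 < b (chart_map c z) by apply/bsupp.
  rewrite mul1r mulr_gt0//=; apply: le_lt_trans s0dl.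
  by rewrite ler_piMr ?(ltW s00)//; have /andP[] := b01 (chart_map c z).
exists [set z | chart_dom c z /\ `|p - chart_map c z| < r].
  apply: filterI; first exact: chart_dom_nbhs.
  have : \forall z \near x, ball p r (chart_map c z).
    by apply: (chart_map_cont cx); exact: nbhsx_ballx.
  by apply: filterS => z; rewrite -ball_normE.
exists F; last first.
  move=> z [cz zr] Fz; rewrite Fz in cz zr.
  have nb : b (chart_map c z) <> 0.
    by have /bsupp := zr => /[swap] ->; rewrite ltxx.
  by have := incr z cz nb; rewrite Fz ltxx.
split.
- split.
  + move=> t t01; exists (chart_lift c (g t t01)); split.
    * by apply: chart_liftK => // y; exact: fimg.
    * by apply: chart_liftK => // y; exact: gimg.
    * move=> V H q sH.
      apply: (@smooth_into_lift _ _ _ _ HA V H (fun=> g t t01) q c S) => //.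
      - by move=> _ y /notS; exact: gid.
      - exact: gimg.
      - move=> cHq; have [_ /(_ c Ac cHq) sc] := sH.
        apply: (smooth_at_comp sc); apply: smooth_open_at.
        exact: (push_inv_smooth L0 bsm b01 bl (small t t01)).
  + move=> V H tau q t01 st sH.
    apply: (@smooth_into_lift _ _ _ _ HA V H (fun q => f (tau q)) q c S) => //.
    * by move=> q' y /notS; exact: fid.
    * by move=> y; exact: fimg.
    * move=> cHq; have [_ /(_ c Ac cHq) sc] := sH.
      apply: smooth_atD => //; apply: smooth_atZ; apply: smooth_atM.
        by apply: smooth_atM => //; exact: smooth_at_cst.
      by apply: (smooth_at_comp1 sc); exact: smooth_open_at.
  + move=> z; apply: chart_lift_id => _.
    by rewrite /f /push !mul0r scale0r addr0.
- move=> t z t01 za; apply: chart_lift_id => cz; apply: fid; apply: b0P => zr.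
  have [_] := near_x _ (lt_trans zr rr1).
  by rewrite chart_mapK// ltNge za.
- move=> z Fz; have cz : chart_dom c z.
    by apply: contrapT => ncz; apply: Fz; exact: chart_lift_out.
  by apply: incr => // bz; apply: Fz; apply: chart_lift_id => _; exact: fid.
Qed.

(** Going back along an orbit from a point of the compact band decreases the
    function by at least a fixed [eta], until the orbit falls below [lo]. *)
Lemma ascending_sweep (F : R -> E -> E) (lo hi : R) :
  continuous sg -> ascending F ->
  compact [set x | lo <= sg x <= hi] ->
  moves_onto F [set x | lo <= sg x <= hi] ->
  exists m : nat, forall x, sg x <= hi -> exists2 z, sg z < lo & iter m (F 1) z = x.
Proof.
move=> csg aF cQ mQ; have [[F1 _ _] _ sF] := aF.
have I1 : (1 : R) \in `[0, 1] by rewrite in_itv/= ler01 lexx.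
have [g [fK gK sg']] := F1 1 I1; have cg := smooth_self_continuous HA sg'.
have [eta eta0 Heta] : exists2 eta : R, 0 < eta &
    forall x, lo <= sg x <= hi -> sg (g x) <= sg x - eta.
  apply: (compact_local_ind (P := fun S => exists2 eta : R, 0 < eta &
    forall x, S x -> sg (g x) <= sg x - eta)) cQ _ _ _ _.
  - by exists 1.
  - by move=> B C BC [e e0 He]; exists e => // x /BC /He.
  - move=> B C [e e0 He] [e' e0' He']; exists (Num.min e e'); first by rewrite lt_min e0.
    move=> x [/He|/He'] /le_trans; apply; rewrite lerD2l lerN2 ge_min lexx ?orbT//.
  - move=> x xQ; pose h z := sg z - sg (g z).
    have hx : 0 < h x.
      have /sF : F 1 (g x) <> g x by apply: mQ; rewrite gK.
      by rewrite gK subr_gt0.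
    have ch : {for x, continuous h}.
      apply: continuousB; first exact: csg.
      exact: (continuous_comp (cg x) (csg (g x))).
    exists [set z | h x / 2 < h z].
      by apply: (ch [set s | h x / 2 < s]); apply: lt_nbhsr; lra.
    exists (h x / 2); first by rewrite divr_gt0.
    by move=> z /=; rewrite /h; lra.
have key k x : sg x <= hi -> exists2 z, sg z < lo \/ sg z <= hi - k%:R * eta &
    iter k (F 1) z = x.
  move=> xhi; elim: k => [|k [z Hz Ez]].
    by exists x => //; right; rewrite mul0r subr0.
  exists (g z); last by rewrite iterSr gK.
  have gz : sg (g z) <= sg z by rewrite -{2}(gK z); exact: ascending_le.
  have [zlo|zlo] := ltP (sg z) lo; first by left; exact: le_lt_trans zlo.
  case: Hz => [|Hz]; first by rewrite ltNge zlo.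
  have zQ : lo <= sg z <= hi.
    rewrite zlo; apply: le_trans Hz _; rewrite gerBl mulr_ge0 ?(ltW eta0)//.
  right; apply: le_trans (Heta z zQ) _; rewrite -natr1 mulrDl mul1r; lra.
(* After [m] steps the total decrease exceeds [hi - lo]. *)
pose m := (Num.truncn ((hi - lo) / eta)).+1.
have Hm : hi - m%:R * eta < lo.
  have : (hi - lo) / eta < m%:R by exact: truncnS_gt.
  rewrite ltr_pdivrMr//; lra.
exists m => x /(key m)[z Hz Ez]; exists z => //.
by case: Hz => // /le_lt_trans; apply.
Qed.

End Dynamics.

(** * Non-critical points, round balls and the theorem *)

Section Noncritical.
Context {R : realType} {n : nat} {E : topologicalType}.
Variables (A : set (chart R n E)) (HA : smooth_manifold A).
Variable (rho : E -> R).
Implicit Types c d : chart R n E.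

(** A negative upper limit is a negative supremum on some product neighbourhood,
    which makes the difference quotients uniformly negative there. *)
Lemma noncritical_descent x : ~ critical_point A rho x ->
  exists c v (r dl : R), [/\ A c, chart_dom c x, 0 < r, 0 < dl &
    forall y t, `|chart_map c x - y| < r -> 0 < t < dl ->
      rho (chart_inv c (y + t *: v)) < rho (chart_inv c y)].
Proof.
move=> ncrit; apply: contrapT => H; apply: ncrit => c Ac cx v.
rewrite leNgt; apply/negP; rewrite /clarke_derivative limf_esupE.
move=> /ereal_inf_lt[_ [B FB <-] supB]; apply: H.
case: FB => -[B1 B2] /= [/nbhs_ballP[r /= r0 rB1] /nbhs_ballP[dl /= dl0 dlB2]] sB.
exists c, v, r, dl; split=> // y t yr /andP[t0 t1].
have Bp : B (y, t).
  apply: sB; split=> /=; first by apply: rB1; rewrite -ball_normE.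
  by apply: dlB2 => //; rewrite /ball /= sub0r normrN gtr0_norm.
have q0 : (((rho (chart_inv c (y + t *: v)) - rho (chart_inv c y)) / t)%:E < 0)%E.
  by apply: le_lt_trans supB; apply: ereal_sup_ubound; exists (y, t).
by move: q0; rewrite lte_fin pmulr_llt0 ?invr_gt0// subr_lt0.
Qed.

(** Where [rho] is negative a descent of [rho] is an ascent of its absolute value.
    Where [rho] is positive the opposite vector is used, and the descent is
    applied at the displaced point; this needs the displaced point to stay near
    [x], whence the smaller radii. *)
Lemma noncritical_abs_ascent (a : R) x : 0 <= a -> continuous rho ->
  a < `|rho x| -> ~ critical_point A rho x ->
  exists c v (r dl : R), [/\ A c, chart_dom c x, 0 < r, 0 < dl &
    (forall y, `|chart_map c x - y| < r ->
      chart_img c y /\ a < `|rho (chart_inv c y)|) /\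
    (forall y t, `|chart_map c x - y| < r -> 0 < t < dl ->
      `|rho (chart_inv c y)| < `|rho (chart_inv c (y + t *: v))|)].
Proof.
move=> a0 crho ax /noncritical_descent[c [v [r [dl [Ac cx r0 dl0 desc]]]]].
have cy := chart_img_map cx.
have cri : {for chart_map c x, continuous (fun y => rho (chart_inv c y))}.
  exact: (continuous_comp (chart_inv_cont cy) (crho _)).
have [rneg|rpos] := ltP (rho x) 0.
  rewrite ltr0_norm// ltrNr in ax.
  have nneg : \forall y \near chart_map c x, rho (chart_inv c y) < - a.
    apply: (cri [set s | s < - a]); rewrite chart_mapK//; exact: lt_nbhsl.
  have [r' /= r'0 Hr'] := (nbhs_ballP _ _).1 (filterI (chart_img_nbhs cy) nneg).
  exists c, v, (Num.min r r'), dl; split=> //; first by rewrite lt_min r0.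
  have nb y : `|chart_map c x - y| < Num.min r r' ->
    chart_img c y /\ rho (chart_inv c y) < - a.
    by rewrite lt_min => /andP[_ yr]; apply: Hr'; rewrite -ball_normE.
  split=> [y /nb[iy ry]|y t yr tI].
    split=> //; have yneg : rho (chart_inv c y) < 0 by lra.
    by rewrite ltr0_norm// ltrNr.
  have [_ ry] := nb y yr; move: yr; rewrite lt_min => /andP[yr _].
  have dy := desc y t yr tI.
  by rewrite !ltr0_norm ?ltrN2//; lra.
rewrite ger0_norm// in ax.
have npos : \forall y \near chart_map c x, a < rho (chart_inv c y).
  apply: (cri [set s | a < s]); rewrite chart_mapK//; exact: lt_nbhsr.
have [r' /= r'0 Hr'] := (nbhs_ballP _ _).1 (filterI (chart_img_nbhs cy) npos).
have v0 : 0 < 2 * (`|v| + 1) by rewrite mulr_gt0// ltr_wpDl.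
exists c, (- v), (Num.min (r / 2) r'), (Num.min dl (r / (2 * (`|v| + 1)))).
split=> //; [by rewrite lt_min r'0 divr_gt0|by rewrite lt_min dl0 divr_gt0|].
have nb y : `|chart_map c x - y| < Num.min (r / 2) r' ->
    chart_img c y /\ a < rho (chart_inv c y).
  by rewrite lt_min => /andP[_ yr]; apply: Hr'; rewrite -ball_normE.
split=> [y /nb[iy ry]|y t yr].
  by split=> //; apply: lt_le_trans ry (ler_norm _).
rewrite lt_min => /and3P[t0 tdl tr].
have [_ ry] := nb y yr; move: yr; rewrite lt_min => /andP[yr _].
set y' := y + t *: - v.
have y'r : `|chart_map c x - y'| < r.
  rewrite /y' scalerN opprB addrCA addrC.
  apply: le_lt_trans (_ : `|chart_map c x - y| + t * `|v| < _).
    by apply: le_trans (ler_normD _ _) _; rewrite normrZ gtr0_norm.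
  move: tr; rewrite ltr_pdivlMr// => tr.
  have : t * (2 * (`|v| + 1)) = 2 * (t * `|v|) + 2 * t by ring.
  by move=> E1; rewrite E1 in tr; lra.
have := desc y' t y'r; rewrite t0 tdl => /(_ isT).
rewrite /y' scalerN subrK -scalerN -/y' => dy.
by rewrite !gtr0_norm; lra.
Qed.

End Noncritical.

Section EuclideanBalls.
Context {R : realType} {n : nat} {E : topologicalType}.
Variables (h : E -> 'rV[R]_n) (hi : 'rV[R]_n -> E) (r : R).
Hypotheses (ch : continuous h) (chi : continuous hi) (hK : cancel h hi) (hiK : cancel hi h).
Hypothesis r0 : 0 < r.

Definition sqnorm (v : 'rV[R]_n) : R := \sum_(i < n) v ord0 i ^+ 2.

Lemma sqnorm_continuous : continuous sqnorm.
Proof.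
have k0 i : Ck_open 0 setT (fun w : 'rV[R]_n => w ord0 i * w ord0 i).
  by apply: (Ck_openM openT); split=> // w _; exact: coord_continuous.
have [c0 _] := Ck_open_sum (index_enum 'I_n) openT k0.
by move=> v; have := c0 v Logic.I.
Qed.

Lemma sqnormZ (t : R) v : sqnorm (t *: v) = t ^+ 2 * sqnorm v.
Proof. by rewrite /sqnorm mulr_sumr; apply: eq_bigr => i _; rewrite mxE exprMn. Qed.

Lemma closed_euclidean_ball_compact : compact [set v | sqnorm v <= r ^+ 2].
Proof.
have clB : closed [set v | sqnorm v <= r ^+ 2].
  by apply: (@preimage_closed _ _ sqnorm [set s | s <= r ^+ 2]) => [? _|];
    [exact: sqnorm_continuous|exact: closed_le].
apply: (subclosed_compact clB (@closed_norm_ball_compact R n 0 r r0)) => v /= vr.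
rewrite sub0r normrN; apply: row_norm_le => [|i]; first exact: ltW.
rewrite -(ler_pXn2r (n := 2))// ?nnegrE ?(ltW r0)//.
apply: le_trans vr; rewrite real_normK ?num_real// /sqnorm (bigD1 i)//= lerDl.
by apply: sumr_ge0 => j _; rewrite sqr_ge0.
Qed.

(** A point of the closed ball is the limit of its radial contractions, read in the
    manifold through the homeomorphism. *)
Lemma closure_open_ball :
  closure [set x | sqnorm (h x) < r ^+ 2] = [set x | sqnorm (h x) <= r ^+ 2].
Proof.
have cq : continuous (fun x => sqnorm (h x)).
  by move=> x; apply: (@continuous_comp _ _ _ h sqnorm); [exact: ch|exact: sqnorm_continuous].
apply/seteqP; split=> [x|x /= xr B Bx].
  have clB : closed [set x | sqnorm (h x) <= r ^+ 2].
    by apply: (@preimage_closed _ _ (fun x => sqnorm (h x)) [set s | s <= r ^+ 2]) => [? _|];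
    [exact: cq|exact: closed_le].
  by move=> clx; apply: clB; apply: closure_subset clx => y /=; exact: ltW.
pose k (t : R) := hi (t *: h x).
have ck : {for 1, continuous k}.
  have c1 : {for 1, continuous (fun t : R => t *: h x)} by exact: scalel_continuous.
  exact: (continuous_comp c1 (@chi _)).
have k1 : k 1 = x by rewrite /k scale1r hK.
have nB : \forall t \near (1 : R)^'-, B (k t).
  by have := cvg_at_left_filter ck; rewrite k1 => /(_ B Bx).
have n0 : \forall t \near (1 : R)^'-, 0 < t < 1.
  near=> t; apply/andP; split; near: t; last exact: nbhs_left_lt.
  by apply: nbhs_left_gt.
have [t [Bt /andP[t0 t1]]] := @filter_ex _ _ (at_left_proper_filter (1 : R)) _ (filterI nB n0).
exists (k t); split=> //=; rewrite /k hiK sqnormZ.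
have t2 : t ^+ 2 < 1 by rewrite expr_lt1// ltW.
have r2 : 0 < r ^+ 2 by rewrite exprn_gt0.
apply: le_lt_trans (_ : t ^+ 2 * r ^+ 2 < _); first by rewrite ler_wpM2l// sqr_ge0.
by rewrite gtr_pMl.
Unshelve. all: by end_near. Qed.

Lemma closed_ball_homeomorphic :
  homeomorphic [set x | sqnorm (h x) <= r ^+ 2] (@euclidean_closed_ball R n).
Proof.
have rN0 : r != 0 by rewrite gt_eqF.
exists (fun x => r^-1 *: h x), (fun v => hi (r *: v)); split.
- move=> x /= xr; split; last by rewrite scalerA divff// scale1r.
  rewrite /euclidean_closed_ball /= -/(sqnorm _) sqnormZ exprVn.
  by rewrite ler_pdivrMl ?exprn_gt0// mulr1.
- move=> v; rewrite /euclidean_closed_ball /= -/(sqnorm _) => v1; split.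
    by rewrite hiK sqnormZ ler_piMr// sqr_ge0.
  by rewrite hiK scalerA mulVf// scale1r.
- apply: continuous_subspaceT => x.
  apply: (@continuous_comp _ _ _ h (fun v => r^-1 *: v)); first exact: ch.
  exact: scaler_continuous.
- apply: continuous_subspaceT => v.
  apply: (@continuous_comp _ _ _ (fun v : 'rV[R]_n => r *: v : 'rV[R]_n) hi); last exact: chi.
  exact: scaler_continuous.
Qed.

End EuclideanBalls.

Theorem theorem1p1 (R : realType) (E : topologicalType)
    (A : set (chart R 4 E))
    (HA : smooth_manifold A)
    (HE : homeomorphic [set: E] [set: 'rV[R]_4])
    (G : chart R 4 E -> E -> 'M[R]_4)
    (HG : riemannian_metric A G)
    (rho : E -> R)
    (Hproper : proper_function rho)
    (Hlip : riemannian_lipschitz A G rho)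
    (Hcrit : bounded_set (critical_values A rho)) :
  DFT_condition A.
Proof.
move=> K cK.
have crho : continuous rho := riemannian_lipschitz_continuous HA HG Hlip.
pose sg x := `|rho x|.
have csg : continuous sg.
  by move=> x; apply: (continuous_comp (crho x)); exact: norm_continuous.
have csub (M : R) : compact [set x | sg x <= M].
  rewrite (_ : [set x | _] = rho @^-1` `[- M, M]%classic).
    exact/Hproper/segment_compact.
  by apply/seteqP; split=> x /=; rewrite /sg in_itv/= ler_norml.
have [h [hi [hP hiP ch chi]]] := HE.
have {}hK x : hi (h x) = x by have [] := hP x I.
have {hP hiP}hiK y : h (hi y) = y by have [] := hiP y I.
have {}ch : continuous h by exact/continuous_subspace_setT.
have {}chi : continuous hi by exact/continuous_subspace_setT.
have [C HC] : exists C : R, forall x, critical_point A rho x -> sg x <= C.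
  have [M [_ HM]] := Hcrit; exists (M + 1) => x cx.
  by apply: (HM (M + 1)); [rewrite ltrDl|exists x].
have [MK HMK] := compact_ubound csg cK.
pose a := Num.max 0 (Num.max C MK).
have a0 : 0 <= a by rewrite le_max lexx.
have aC : C <= a by rewrite !le_max lexx orbT.
have aK : MK <= a by rewrite !le_max lexx !orbT.
(* The gap between [a] and [lo] leaves room for a push around a point of level
   [lo] to be supported in [{sg > a}]. *)
pose lo := a + 1.
have cq : continuous (fun x => sqnorm (h x)).
  by move=> x; apply: (@continuous_comp _ _ _ h sqnorm); [exact: ch|exact: sqnorm_continuous].
have [N HN] := compact_ubound cq (csub lo).
(* [r >= 1] and [r > N], hence [r ^ 2 > N]. *)
pose r := `|N| + 1; have r0 : 0 < r by rewrite ltr_wpDl.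
pose U := [set x | sqnorm (h x) < r ^+ 2].
have loU x : sg x <= lo -> U x.
  move=> /HN HNx; rewrite /U /=; apply: le_lt_trans HNx _.
  apply: le_lt_trans (ler_norm _) _; rewrite /r; have := normr_ge0 N.
  by move: (`|N|) => s s0; nra.
have clU := closure_open_ball ch chi hK hiK r0.
have cB : compact (closure U).
  rewrite clU (_ : [set x | _] = hi @` [set v | sqnorm v <= r ^+ 2]).
    apply: continuous_compact; last exact: closed_euclidean_ball_compact.
    exact: continuous_subspaceT.
  apply/seteqP; split=> [x /= xr|_ /= [v vr <-]]; last by rewrite hiK.
  by exists (h x) => //; rewrite hK.
have [hic Hhi] := compact_ubound csg cB.
have cQ : compact [set x | lo <= sg x <= hic].
  have clo : closed [set x | lo <= sg x].
    by apply: (@preimage_closed _ _ sg [set s | lo <= s]) => [? _|];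
    [exact: csg|exact: closed_ge].
  rewrite (_ : [set x | _] = [set x | sg x <= hic] `&` [set x | lo <= sg x]).
    exact: compact_closedI.
  by apply/seteqP; split=> x /=; [move=> /andP[]|move=> [-> ->]].
have [F aF mF] : exists2 F, ascending A sg a F & moves_onto F [set x | lo <= sg x <= hic].
  apply: (compact_local_ind (P := fun S =>
    exists2 F, ascending A sg a F & moves_onto F S)) cQ _ _ _ _.
  - by exists (fun _ x => x); [exact: ascending_id|move=> z].
  - by move=> B D BD [F aF mF]; exists F => // z /BD; exact: mF.
  - move=> B D [F aF mF] [F' aF' mF'].
    exists (fun t x => F t (F' t x)); first exact: ascending_comp.
    exact: (moves_onto_comp aF aF' mF mF').
  - move=> x /andP[xlo _].
    have ax : a < sg x by apply: lt_le_trans xlo; rewrite /lo ltrDl.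
    have nx : ~ critical_point A rho x by move=> /HC; lra.
    have [c [v [r1 [dl [Ac cx r10 dl0 [nb up]]]]]] := noncritical_abs_ascent a0 crho ax nx.
    exact: (ascending_local HA Ac cx r10 dl0 nb up).
have [m Hm] := ascending_sweep HA csg aF cQ mF.
have [iF fixF _] := aF.
have Ksub x : K x -> sg x <= a by move=> /HMK /le_trans; apply.
exists U; split.
- rewrite openE => x Ux; apply: (cq x [set s | s < r ^+ 2]); exact: lt_nbhsl.
- by move=> x /Ksub xa; apply: loU; apply: le_trans xa _; rewrite lerDl.
- by rewrite clU; exact: closed_ball_homeomorphic.
- exists (fun t => iter m (F t)); split.
  + exact/isotopy_ambient/isotopy_iter.
  + move=> x /Hhi /Hm[z zlo zx]; exists z => //; apply: loU; exact: ltW.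
  + move=> t x t01 /Ksub xa; elim: (m) => //= k ->; exact: fixF.
Qed.
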